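(* Let $(S,\mathfrak{m})$ be a complete regular local ring of dimension $2$. Let $R=S/(f)$ be a reduced hypersurface, and assume that $f= f_1\cdots f_n$ is a factorization of $f$ into prime elements with $f_i \notin \mathfrak{m}^2$ for each $i$. Let $S_i=S/(\prod_{j=1}^i f_{j})$ be the partial normalizations of $R$ and set $T=\bigoplus_{i=1}^n S_i$. Then $\operatorname{gldim} \operatorname{End}_R(T) = 3$.
   Context: Here $1\le i\le n$, and $\operatorname{gldim}$ denotes global dimension.
   Formalization: The formal theorem assumes n ≥ 2; for n = 1 the claim is false, since then R = S/(f_1) is a discrete valuation ring, T = R, and End_R(T) = R has global dimension 1. *)

(* Defs.v *)
From HB Require Import structures.
From mathcomp Require Import all_boot all_algebra.
From mathcomp Require Import boolp classical_sets.

Set Implicit Arguments.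
Unset Strict Implicit.
Unset Printing Implicit Defensive.

Import GRing.Theory.
Local Open Scope classical_set_scope.
Local Open Scope quotient_scope.
Local Open Scope ring_scope.

Section CommutativeRings.
Variable S : comPzRingType.
Implicit Types (I J P m : set S) (p x y : S).

Definition is_ideal I : Prop :=
  [/\ I 0, forall x y, I x -> I y -> I (x + y) & forall a x, I x -> I (a * x)].

Definition generated_by I k (g : 'I_k -> S) : Prop :=
  I = [set x | exists a : 'I_k -> S, x = \sum_(i < k) a i * g i].

Definition noetherian : Prop :=
  forall I, is_ideal I -> exists k (g : 'I_k -> S), generated_by I g.

Definition prime_ideal P : Prop :=
  [/\ is_ideal P, ~ P 1 & forall x y, P (x * y) -> P x \/ P y].

Definition maximal_ideal m : Prop :=
  [/\ is_ideal m, ~ m 1 &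
      forall I, is_ideal I -> ~ I 1 -> m `<=` I -> I = m].

Definition local_ring m : Prop :=
  maximal_ideal m /\ forall I, maximal_ideal I -> I = m.

Definition prime_chain (d : nat) : Prop :=
  exists P : nat -> set S,
    (forall i, (i <= d)%N -> prime_ideal (P i)) /\
    (forall i, (i < d)%N -> P i `<` P i.+1).

Definition krull_dim (d : nat) : Prop :=
  prime_chain d /\ forall e, prime_chain e -> (e <= d)%N.

Definition regular_local_ring m (d : nat) : Prop :=
  [/\ noetherian, local_ring m, krull_dim d &
      exists g : 'I_d -> S, generated_by m g].

Definition ideal_mul I J : set S :=
  [set x | exists k (a b : 'I_k -> S),
     [/\ forall i, I (a i), forall i, J (b i) & x = \sum_(i < k) a i * b i]].

Definition ideal_exp I (k : nat) : set S := iter k (ideal_mul I) setT.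

Definition adic_separated m : Prop :=
  forall x, (forall k, ideal_exp m k x) -> x = 0.

Definition adic_cauchy m (u : nat -> S) : Prop :=
  forall k, exists N, forall i j, (N <= i)%N -> (N <= j)%N ->
    ideal_exp m k (u i - u j).

Definition adic_cvg m (u : nat -> S) (l : S) : Prop :=
  forall k, exists N, forall i, (N <= i)%N -> ideal_exp m k (u i - l).

Definition adic_complete m : Prop :=
  adic_separated m /\
  forall u, adic_cauchy m u -> exists l, adic_cvg m u l.

Definition divides x y : Prop := exists a, y = a * x.

Definition prime_element p : Prop :=
  [/\ p <> 0, ~ divides p 1 &
      forall x y, divides p (x * y) -> divides p x \/ divides p y].

Definition reduced_ring : Prop := forall x k, x ^+ k = 0 -> x = 0.

End CommutativeRings.

Section PrincipalQuotient.
Variables (S : comPzRingType) (g : S).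

Definition principal (x : S) : bool := `[< divides g x >].

Fact principal_zmod_closed : zmod_closed principal.
Proof.
split; first by apply/asboolP; exists 0; rewrite mul0r.
move=> x y /asboolP[a ->] /asboolP[b ->]; apply/asboolP.
by exists (a - b); rewrite mulrBl.
Qed.
HB.instance Definition _ := GRing.isZmodClosed.Build S principal
  principal_zmod_closed.

Definition principal_ideal : zmodClosed S :=
  GRing.ZmodClosed.clone S principal _.

(* The library's ring structure on {ideal_quot I} asks for a bundled proof that
   I is proper, so only its additive quotient is reused: S/(g) is a ring,
   possibly zero, for every g. *)
Definition pquot : Type := {ideal_quot principal_ideal}.
HB.instance Definition _ := GRing.Zmodule.on pquot.

Definition pquot_pi (x : S) : pquot := \pi_{ideal_quot principal_ideal} x.
Definition pquot_repr (u : pquot) : S :=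
  repr (u : {ideal_quot principal_ideal}).

Lemma pquot_reprK : cancel pquot_repr pquot_pi.
Proof. exact: reprK. Qed.

Lemma pquot_eq x y : pquot_pi x = pquot_pi y <-> divides g (x - y).
Proof.
split=> [/eqP|H]; first by rewrite -Quotient.idealrBE => /asboolP.
by apply/eqP; rewrite -Quotient.idealrBE; apply/asboolP.
Qed.

Lemma pquot_piD x y : pquot_pi (x + y) = pquot_pi x + pquot_pi y.
Proof. exact: raddfD. Qed.

Definition pquot_one : pquot := pquot_pi 1.
Definition pquot_mul (u v : pquot) : pquot :=
  pquot_pi (pquot_repr u * pquot_repr v).

Lemma pquot_piM x y : pquot_mul (pquot_pi x) (pquot_pi y) = pquot_pi (x * y).
Proof.
have [a ha] := (pquot_eq _ _).1 (pquot_reprK (pquot_pi x)).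
have [b hb] := (pquot_eq _ _).1 (pquot_reprK (pquot_pi y)).
apply/pquot_eq; exists (a * pquot_repr (pquot_pi y) + x * b).
rewrite mulrDl -(mulrA x) -hb mulrBr mulrAC -ha mulrBl.
by rewrite addrA subrK.
Qed.

Fact pquot_mulA : associative pquot_mul.
Proof.
move=> u v w; rewrite -[u]pquot_reprK -[v]pquot_reprK -[w]pquot_reprK.
by rewrite !pquot_piM mulrA.
Qed.
Fact pquot_mulC : commutative pquot_mul.
Proof. by move=> u v; rewrite /pquot_mul mulrC. Qed.
Fact pquot_mul1 : left_id pquot_one pquot_mul.
Proof. by move=> u; rewrite -[u]pquot_reprK pquot_piM mul1r. Qed.
Fact pquot_mulDl : left_distributive pquot_mul +%R.
Proof.
move=> u v w; rewrite -[u]pquot_reprK -[v]pquot_reprK -[w]pquot_reprK.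
by rewrite -pquot_piD !pquot_piM -pquot_piD mulrDl.
Qed.
HB.instance Definition _ := GRing.Zmodule_isComPzRing.Build pquot
  pquot_mulA pquot_mulC pquot_mul1 pquot_mulDl.

End PrincipalQuotient.

Section EndomorphismRing.
Variables (R : pzRingType) (M : lmodType R).

(* Multiplication is composition: (f * g) x = f (g x). *)
Definition endo : Type := {linear M -> M}.
Definition endo_fun (f : endo) : M -> M := (f : {linear M -> M}).

Lemma endoP (f g : endo) : endo_fun f =1 endo_fun g -> f = g.
Proof.
move=> /funext; case: f g => [f [[cf] [sf]]] [g [[cg] [sg]]] /= efg.
rewrite /endo_fun /= in efg; case: _ / efg cg sg => cg sg.
by rewrite (Prop_irrelevance cf cg) (Prop_irrelevance sf sg).
Qed.

HB.instance Definition _ := gen_eqMixin endo.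
HB.instance Definition _ := gen_choiceMixin endo.

Definition endo_zero : endo := (\0 : {linear M -> M}).
Definition endo_opp (f : endo) : endo := (\- f : {linear M -> M}).
Definition endo_add (f g : endo) : endo := (f \+ g : {linear M -> M}).
Definition endo_one : endo := (idfun : {linear M -> M}).
Definition endo_mul (f g : endo) : endo := (f \o g : {linear M -> M}).

Fact endo_addA : associative endo_add.
Proof. by move=> f g h; apply: endoP => x; exact: addrA. Qed.
Fact endo_addC : commutative endo_add.
Proof. by move=> f g; apply: endoP => x; exact: addrC. Qed.
Fact endo_add0 : left_id endo_zero endo_add.
Proof. by move=> f; apply: endoP => x; exact: add0r. Qed.
Fact endo_addN : left_inverse endo_zero endo_opp endo_add.
Proof. by move=> f; apply: endoP => x; exact: addNr. Qed.
HB.instance Definition _ := GRing.isZmodule.Build endo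
  endo_addA endo_addC endo_add0 endo_addN.

Fact endo_mulA : associative endo_mul.
Proof. by move=> f g h; apply: endoP. Qed.
Fact endo_mul1l : left_id endo_one endo_mul.
Proof. by move=> f; apply: endoP. Qed.
Fact endo_mul1r : right_id endo_one endo_mul.
Proof. by move=> f; apply: endoP. Qed.
Fact endo_mulDl : left_distributive endo_mul +%R.
Proof. by move=> f g h; apply: endoP. Qed.
Fact endo_mulDr : right_distributive endo_mul +%R.
Proof. by move=> f g h; apply: endoP => x; exact: (raddfD (f : {linear M -> M})). Qed.
HB.instance Definition _ := GRing.Zmodule_isPzRing.Build endo
  endo_mulA endo_mul1l endo_mul1r endo_mulDl endo_mulDr.

End EndomorphismRing.

Section DirectSum.
Variables (R : pzRingType) (I : finType) (M : I -> lmodType R).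

(* I is finite, so the direct sum is the full product. *)
Definition dirsum : Type := forall i, M i.
HB.instance Definition _ := Choice.on dirsum.
Implicit Types u v w : dirsum.

Definition dirsum_zero : dirsum := fun=> 0.
Definition dirsum_opp u : dirsum := fun i => - u i.
Definition dirsum_add u v : dirsum := fun i => u i + v i.
Definition dirsum_scale (a : R) u : dirsum := fun i => a *: u i.

Fact dirsum_addA : associative dirsum_add.
Proof. by move=> u v w; apply: functional_extensionality_dep => i; exact: addrA. Qed.
Fact dirsum_addC : commutative dirsum_add.
Proof. by move=> u v; apply: functional_extensionality_dep => i; exact: addrC. Qed.
Fact dirsum_add0 : left_id dirsum_zero dirsum_add.
Proof. by move=> u; apply: functional_extensionality_dep => i; exact: add0r. Qed.
Fact dirsum_addN : left_inverse dirsum_zero dirsum_opp dirsum_add.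
Proof. by move=> u; apply: functional_extensionality_dep => i; exact: addNr. Qed.
HB.instance Definition _ := GRing.isZmodule.Build dirsum
  dirsum_addA dirsum_addC dirsum_add0 dirsum_addN.

Fact dirsum_scaleA a b u :
  dirsum_scale a (dirsum_scale b u) = dirsum_scale (a * b) u.
Proof. by apply: functional_extensionality_dep => i; exact: scalerA. Qed.
Fact dirsum_scale1 : left_id 1 dirsum_scale.
Proof. by move=> u; apply: functional_extensionality_dep => i; exact: scale1r. Qed.
Fact dirsum_scaleDr : right_distributive dirsum_scale +%R.
Proof. by move=> a u v; apply: functional_extensionality_dep => i; exact: scalerDr. Qed.
Fact dirsum_scaleDl u : {morph dirsum_scale^~ u : a b / a + b}.
Proof. by move=> a b; apply: functional_extensionality_dep => i; exact: scalerDl. Qed.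
HB.instance Definition _ := GRing.Zmodule_isLmodule.Build R dirsum
  dirsum_scaleA dirsum_scale1 dirsum_scaleDr dirsum_scaleDl.

End DirectSum.

Section GlobalDimension.
Variable A : pzRingType.

Definition projective (P : lmodType A) : Prop :=
  forall (M N : lmodType A) (g : {linear M -> N}) (h : {linear P -> N}),
    (forall y, exists x, g x = y) ->
    exists k : {linear P -> M}, forall x, g (k x) = h x.

(* M has a projective resolution
     ... -> P 2 -> P 1 -> P 0 -> M -> 0   with P k = 0 for all k > d. *)
Definition proj_dim_le (M : lmodType A) (d : nat) : Prop :=
  exists (P : nat -> lmodType A)
         (del : forall k, {linear P k.+1 -> P k}) (eps : {linear P 0%N -> M}),
    [/\ forall k, projective (P k),
        forall y, exists x, eps x = y,
        forall x, eps x = 0 <-> exists z, del 0%N z = x,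
        forall k x, del k x = 0 <-> exists z, del k.+1 z = x &
        forall k, (d < k)%N -> forall x : P k, x = 0].

Definition lgldim_le (d : nat) : Prop :=
  forall M : lmodType A, proj_dim_le M d.

Definition lgldim (d : nat) : Prop :=
  lgldim_le d /\ forall e, lgldim_le e -> (d <= e)%N.

End GlobalDimension.

(* Left modules over the converse ring are right A-modules: both the left and
   the right global dimension of A are required to be d. *)
Definition gldim (A : pzRingType) (d : nat) : Prop :=
  lgldim A d /\ lgldim A^c d.

Section PartialNormalizations.
Variables (S : comPzRingType) (n : nat) (f : 'I_n -> S).

Definition hypersurface : Type := pquot (\prod_(j < n) f j).
HB.instance Definition _ := GRing.ComPzRing.on hypersurface.

(* Indices are shifted: i : 'I_n stands for the index i + 1 of {1, ..., n}. *)
Definition partial_prod (i : 'I_n) : S := \prod_(j < n | (j <= i)%N) f j.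
Definition partial_normalization (i : 'I_n) : Type := pquot (partial_prod i).

Section Scale.
Variable i : 'I_n.
HB.instance Definition _ := GRing.ComPzRing.on (partial_normalization i).

Definition pn_map (r : hypersurface) : partial_normalization i :=
  pquot_pi (partial_prod i) (pquot_repr r).

Lemma pn_map_pi x : pn_map (pquot_pi _ x) = pquot_pi (partial_prod i) x.
Proof.
have [a ha] := (pquot_eq _ _ _).1 (pquot_reprK (pquot_pi (\prod_(j < n) f j) x)).
apply/pquot_eq; exists (a * \prod_(j < n | ~~ (j <= i)%N) f j).
by rewrite ha (bigID (fun j : 'I_n => (j <= i)%N)) /= mulrA mulrAC.
Qed.

Lemma pn_mapD : {morph pn_map : r s / r + s}.
Proof.
move=> r s; rewrite -[r]pquot_reprK -[s]pquot_reprK.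
by rewrite -[X in pn_map X]pquot_piD !pn_map_pi -pquot_piD.
Qed.

Lemma pn_mapM : {morph pn_map : r s / r * s}.
Proof.
move=> r s; rewrite -[r]pquot_reprK -[s]pquot_reprK.
by rewrite -[X in pn_map X]/(pquot_mul _ _) pquot_piM !pn_map_pi -pquot_piM.
Qed.

Lemma pn_map1 : pn_map 1 = 1.
Proof. exact: pn_map_pi. Qed.

Definition pn_scale (r : hypersurface) (x : partial_normalization i) :
  partial_normalization i := pn_map r * x.

Fact pn_scaleA a b u : pn_scale a (pn_scale b u) = pn_scale (a * b) u.
Proof. by rewrite /pn_scale pn_mapM mulrA. Qed.
Fact pn_scale1 : left_id 1 pn_scale.
Proof. by move=> u; rewrite /pn_scale pn_map1 mul1r. Qed.
Fact pn_scaleDr : right_distributive pn_scale +%R.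
Proof. by move=> a u v; exact: mulrDr. Qed.
Fact pn_scaleDl u : {morph pn_scale^~ u : a b / a + b}.
Proof. by move=> a b; rewrite /pn_scale pn_mapD mulrDl. Qed.
HB.instance Definition _ := GRing.Zmodule_isLmodule.Build hypersurface
  (partial_normalization i) pn_scaleA pn_scale1 pn_scaleDr pn_scaleDl.

End Scale.

Definition sum_partial_normalizations : lmodType hypersurface :=
  dirsum (fun i : 'I_n => partial_normalization i : lmodType hypersurface).

End PartialNormalizations.

(* Main.v *)
Require Import Defs.
From HB Require Import structures.
From mathcomp Require Import all_boot all_algebra.
From mathcomp Require Import boolp classical_sets wochoice.

(* A := End_R(T) is a double quiver algebra over S: writing e_k for the
   projection onto S_k, f_k for the k-th factor (k >= 0) and m = (f_k, t_k), it is
   generated by the projections a_k : S_(k+1) -> S_k and the inclusions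
   b_k : S_k -> S_(k+1), with a_k b_k = f_(k+1) e_k, b_k a_k = f_(k+1) e_(k+1)
   and f_0 e_0 = 0.  Exchanging a and b gives an isomorphism of A with A^c, so
   left modules suffice.
   Put Delta_k := A e_k / A a_(k-1), whose row at a vertex j >= k is the discrete
   valuation ring S/(f_k).  It has projective dimension at most 1 (a_(k-1) is
   surjective, so A e_(k-1) -> A e_k is injective), E_k := Delta_k / t_k Delta_k
   has at most 2, and the simple module at k, being E_k / E_(k+1), has at most 3.
   A cyclic module is filtered by quotients of the Delta_k; these are Delta_k
   itself or iterated extensions of simple modules.  Auslander's lemma on
   well-ordered filtrations then bounds the dimension of every module by 3.
   For the lower bound, two syzygies of A e_0 / A b_0 lead to Delta_1, which is
   not projective. *)

Set Implicit Arguments.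
Unset Strict Implicit.
Unset Printing Implicit Defensive.

Import GRing.Theory.
Local Open Scope ring_scope.
Local Open Scope quotient_scope.

(** * Submodules, quotient modules and direct sums *)

Section Submodules.
Variables (A : pzRingType) (M : lmodType A).

(** The dimension bound has to cover all modules, not only finitely generated ones, so cyclic
    modules are reached through a well-ordered generating family, and projective dimension is
    handled one cover at a time. The modules of the main computation are quotients A/U by left
    ideals. Writing U : c for the set of r with r c in U, the sequence 0 -> A/(U : c) -> A/U -> A/(U
    + A c) -> 0 turns statements about submodules and quotients into computations with ideals, row
    by row along the idempotents. Few facts about S enter: m = (f_k, t_k), S is a domain, the f_k
    are primes none of which divides another (this is reducedness), and modulo f_k every nonzero
    element has a multiple equal to a power of t_k (this is f_k outside m^2). They rest on
    completeness: a relation x = c y + z x' with z in m is iterated and summed as a power series in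
    z, in the place of Nakayama's lemma and Krull's intersection theorem. *)

Definition is_submodule (U : M -> Prop) : Prop :=
  [/\ U 0, forall x y, U x -> U y -> U (x + y) & forall a x, U x -> U (a *: x)].

Record submodule := Submodule { sub_set :> M -> Prop; _ : is_submodule sub_set }.

Variable U : submodule.

Lemma sub0 : U 0. Proof. by case: U => ? []. Qed.
Lemma subD x y : U x -> U y -> U (x + y).
Proof. by case: U => ? [? H ?]; exact: H. Qed.
Lemma subZ a x : U x -> U (a *: x).
Proof. by case: U => ? [? ? H]; exact: H. Qed.
Lemma subN x : U x -> U (- x).
Proof. by rewrite -scaleN1r; exact: subZ. Qed.
Lemma subB x y : U x -> U y -> U (x - y).
Proof. by move=> Ux /subN; exact: subD. Qed.

Definition sub_pred : pred M := fun x => `[< U x >].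

Fact sub_pred_closed : submod_closed sub_pred.
Proof.
split; first exact/asboolP/sub0.
by move=> a x y /asboolP Ux /asboolP Uy; apply/asboolP/subD => //; exact: subZ.
Qed.
HB.instance Definition _ := GRing.isSubmodClosed.Build A M sub_pred sub_pred_closed.

Definition submod_type : Type := {x : M | sub_pred x}.
HB.instance Definition _ := SubChoice.on submod_type.
HB.instance Definition _ := [SubChoice_isSubLmodule of submod_type by <:].

Definition sub_incl : submod_type -> M := val.
HB.instance Definition _ := GRing.Linear.copy sub_incl (val : submod_type -> M).

Definition in_sub x (Ux : U x) : submod_type := exist sub_pred x (asboolT Ux).

Lemma sub_inclP (u : submod_type) : U (sub_incl u).
Proof. exact/asboolP/(valP u). Qed.

Lemma sub_incl_inj : injective sub_incl.
Proof. exact: val_inj. Qed.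

End Submodules.
Arguments in_sub {A M U x}.

Section LinearMaps.
Variable A : pzRingType.
Implicit Types M N P Q K X : lmodType A.

Definition mk_linear M N (f : M -> N) (f_lin : linear f) : {linear M -> N} :=
  HB.pack f (GRing.isLinear.Build A M N *:%R f f_lin).

Lemma lift_along_inj X K P (g : {linear X -> P}) (i : {linear K -> P}) :
  injective i -> (forall x, exists k, i k = g x) ->
  exists h : {linear X -> K}, forall x, i (h x) = g x.
Proof.
move=> i_inj /choice[h ih].
have h_lin : linear h by move=> a x y; apply: i_inj; rewrite linearP !ih linearP.
by exists (mk_linear h_lin).
Qed.

Lemma factor_through_surj N Q M (q : {linear N -> Q}) (g : {linear N -> M}) :
  (forall y, exists x, q x = y) -> (forall u, q u = 0 -> g u = 0) ->
  exists h : {linear Q -> M}, forall u, h (q u) = g u.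
Proof.
move=> /choice[r qr] q0.
have gE u v : q u = q v -> g u = g v.
  move=> /eqP; rewrite -subr_eq0 -linearB => /eqP /q0.
  by rewrite linearB => /eqP; rewrite subr_eq0 => /eqP.
have h_lin : linear (g \o r).
  by move=> a x y; rewrite /= -linearP; apply: gE; rewrite linearP !qr.
by exists (mk_linear h_lin) => u; apply: gE.
Qed.

End LinearMaps.

Section QuotientModules.
Variables (A : pzRingType) (M : lmodType A) (U : submodule M).

Definition sub_zmod : zmodClosed M := GRing.ZmodClosed.clone M (sub_pred U) _.

Definition quotmod : Type := {ideal_quot sub_zmod}.
HB.instance Definition _ := GRing.Zmodule.on quotmod.

Definition quotmod_pi (x : M) : quotmod := \pi_{ideal_quot sub_zmod} x.
Definition quotmod_repr (u : quotmod) : M := repr (u : {ideal_quot sub_zmod}).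

Lemma quotmod_reprK : cancel quotmod_repr quotmod_pi.
Proof. exact: reprK. Qed.

Lemma quotmod_eq x y : quotmod_pi x = quotmod_pi y <-> U (x - y).
Proof.
split=> [/eqP|H]; first by rewrite -Quotient.idealrBE => /asboolP.
by apply/eqP; rewrite -Quotient.idealrBE; apply/asboolP.
Qed.

Lemma quotmod_piD x y : quotmod_pi (x + y) = quotmod_pi x + quotmod_pi y.
Proof. exact: raddfD. Qed.

Definition quotmod_scale (a : A) (u : quotmod) : quotmod :=
  quotmod_pi (a *: quotmod_repr u).

Lemma quotmod_piZ a x : quotmod_scale a (quotmod_pi x) = quotmod_pi (a *: x).
Proof.
apply/quotmod_eq; rewrite -scalerBr; apply: subZ.
by apply/quotmod_eq; rewrite quotmod_reprK.
Qed.

Fact quotmod_scaleA a b u :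
  quotmod_scale a (quotmod_scale b u) = quotmod_scale (a * b) u.
Proof. by rewrite -[u]quotmod_reprK !quotmod_piZ scalerA. Qed.
Fact quotmod_scale1 : left_id 1 quotmod_scale.
Proof. by move=> u; rewrite -[u]quotmod_reprK quotmod_piZ scale1r. Qed.
Fact quotmod_scaleDr : right_distributive quotmod_scale +%R.
Proof.
move=> a u v; rewrite -[u]quotmod_reprK -[v]quotmod_reprK.
by rewrite -quotmod_piD !quotmod_piZ -quotmod_piD scalerDr.
Qed.
Fact quotmod_scaleDl u : {morph quotmod_scale^~ u : a b / a + b}.
Proof.
move=> a b; rewrite -[u]quotmod_reprK !quotmod_piZ -quotmod_piD.
by rewrite scalerDl.
Qed.
HB.instance Definition _ := GRing.Zmodule_isLmodule.Build A quotmod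
  quotmod_scaleA quotmod_scale1 quotmod_scaleDr quotmod_scaleDl.

Fact quotmod_pi_linear : linear quotmod_pi.
Proof.
by move=> a x y; rewrite quotmod_piD -[in LHS]quotmod_piZ.
Qed.
HB.instance Definition _ := GRing.isLinear.Build A M quotmod *:%R quotmod_pi
  quotmod_pi_linear.

Lemma quotmod_pi_eq0 x : quotmod_pi x = 0 <-> U x.
Proof. by rewrite -[0](raddf0 quotmod_pi) quotmod_eq subr0. Qed.

Lemma quotmod_pi_surj y : exists x, quotmod_pi x = y.
Proof. by exists (quotmod_repr y); rewrite quotmod_reprK. Qed.

End QuotientModules.
Arguments quotmod_pi {A M} U.

Lemma projective_retract (A : pzRingType) (M P : lmodType A)
    (i : {linear M -> P}) (p : {linear P -> M}) :
  (forall x, p (i x) = x) -> projective P -> projective M.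
Proof.
move=> pi P_proj X Y g h g_surj.
have [k gk] := P_proj X Y g (h \o p) g_surj.
by exists (k \o i) => x /=; rewrite gk /= pi.
Qed.

Lemma projective_regular (A : pzRingType) : projective (A^o : lmodType A).
Proof.
move=> X Y g h g_surj; have [x gx] := g_surj (h 1).
have k_lin : linear (fun a : A^o => a *: x : X).
  by move=> a b c; rewrite scalerDl scalerA.
exists (mk_linear k_lin) => a /=; rewrite linearZ /= gx -linearZ /=.
by congr (h _); exact: mulr1.
Qed.

Section DirectSum.
Variables (A : pzRingType) (I : eqType) (P : I -> lmodType A).

Definition fprod : Type := forall i, P i.
HB.instance Definition _ := Choice.on fprod.

Definition fprod_zero : fprod := fun=> 0.
Definition fprod_opp (u : fprod) : fprod := fun i => - u i.
Definition fprod_add (u v : fprod) : fprod := fun i => u i + v i.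
Definition fprod_scale (a : A) (u : fprod) : fprod := fun i => a *: u i.

Fact fprod_addA : associative fprod_add.
Proof. by move=> u v w; apply: functional_extensionality_dep => i; exact: addrA. Qed.
Fact fprod_addC : commutative fprod_add.
Proof. by move=> u v; apply: functional_extensionality_dep => i; exact: addrC. Qed.
Fact fprod_add0 : left_id fprod_zero fprod_add.
Proof. by move=> u; apply: functional_extensionality_dep => i; exact: add0r. Qed.
Fact fprod_addN : left_inverse fprod_zero fprod_opp fprod_add.
Proof. by move=> u; apply: functional_extensionality_dep => i; exact: addNr. Qed.
HB.instance Definition _ := GRing.isZmodule.Build fprod
  fprod_addA fprod_addC fprod_add0 fprod_addN.

Fact fprod_scaleA a b u : fprod_scale a (fprod_scale b u) = fprod_scale (a * b) u.
Proof. by apply: functional_extensionality_dep => i; exact: scalerA. Qed.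
Fact fprod_scale1 : left_id 1 fprod_scale.
Proof. by move=> u; apply: functional_extensionality_dep => i; exact: scale1r. Qed.
Fact fprod_scaleDr : right_distributive fprod_scale +%R.
Proof. by move=> a u v; apply: functional_extensionality_dep => i; exact: scalerDr. Qed.
Fact fprod_scaleDl u : {morph fprod_scale^~ u : a b / a + b}.
Proof. by move=> a b; apply: functional_extensionality_dep => i; exact: scalerDl. Qed.
HB.instance Definition _ := GRing.Zmodule_isLmodule.Build A fprod
  fprod_scaleA fprod_scale1 fprod_scaleDr fprod_scaleDl.

Definition finite_support (v : fprod) : Prop :=
  exists s : seq I, forall i, v i != 0 -> i \in s.

Fact finite_support_sub : is_submodule finite_support.
Proof.
split; first by exists [::] => i; rewrite eqxx.
  move=> u v [s us] [t vt]; exists (s ++ t) => i uvi; rewrite mem_cat.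
  have [ui0|/us -> //] := eqVneq (u i) 0.
  by rewrite (vt i) ?orbT //; move: uvi; rewrite /= {1}/GRing.add /= /fprod_add ui0 add0r.
move=> a u [s us]; exists s => i aui; apply: us; apply: contraNneq aui => ui0.
by rewrite {1}/GRing.scale /= /fprod_scale ui0 scaler0.
Qed.

(** The index set is arbitrary, since it will be a generating family of a module; hence finite
    supports inside the full product. *)
Definition dsum : lmodType A := submod_type (Submodule finite_support_sub).

Definition dsum_fun (v : dsum) : fprod := val v.

Lemma dsumP (v w : dsum) : (forall i, dsum_fun v i = dsum_fun w i) -> v = w.
Proof. by move=> vw; apply/val_inj/functional_extensionality_dep. Qed.

Lemma dsum_coordP i : linear (fun v : dsum => dsum_fun v i).
Proof. by []. Qed.
Definition dcoord i : {linear dsum -> P i} := mk_linear (dsum_coordP i).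

Lemma dsum_eq (v w : dsum) : (forall i, dcoord i v = dcoord i w) -> v = w.
Proof. exact: dsumP. Qed.

Lemma dsum_support (v : dsum) :
  exists s : seq I, uniq s /\ forall i, dcoord i v != 0 -> i \in s.
Proof.
have /asboolP[s vs] := valP v; exists (undup s).
by split=> [|i]; rewrite ?undup_uniq ?mem_undup //; exact: vs.
Qed.

Definition single_fun i (p : P i) : fprod := fun j =>
  if @eqP I i j is ReflectT e then ecast k (P k) e p else 0.

Lemma single_fun_id i p : @single_fun i p i = p.
Proof. by rewrite /single_fun; case: eqP => // e; rewrite eq_axiomK. Qed.

Lemma single_fun_neq i j p : j != i -> @single_fun i p j = 0.
Proof. by rewrite eq_sym /single_fun; case: eqP. Qed.

Fact single_fun_finite i p : finite_support (@single_fun i p).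
Proof.
exists [:: i] => j pj; rewrite inE; apply: contraNT pj => ji.
by rewrite single_fun_neq.
Qed.

Definition single_def i (p : P i) : dsum :=
  in_sub (U := Submodule finite_support_sub) (single_fun_finite p).

Fact single_linear i : linear (@single_def i).
Proof.
move=> a p q; apply: dsum_eq => j; rewrite linearP /=.
have [->|ji] := eqVneq j i; first by rewrite /= /dsum_fun /= !single_fun_id.
by rewrite /dsum_fun /= !single_fun_neq // scaler0 addr0.
Qed.
Definition single i : {linear P i -> dsum} := mk_linear (@single_linear i).

Lemma dcoord_single i p : dcoord i (single i p) = p.
Proof. exact: single_fun_id. Qed.

Lemma dcoord_single_neq i j p : j != i -> dcoord j (single i p) = 0.
Proof. exact: single_fun_neq. Qed.

Section Copairing.
Variables (M : lmodType A) (phi : forall i, {linear P i -> M}).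

Lemma support_sum_eq (v : dsum) (s t : seq I) : uniq s -> uniq t ->
  (forall i, dcoord i v != 0 -> i \in s) ->
  (forall i, dcoord i v != 0 -> i \in t) ->
  \sum_(i <- s) phi i (dcoord i v) = \sum_(i <- t) phi i (dcoord i v).
Proof.
move=> us ut vs vt.
have restrict (r : seq I) : \sum_(i <- r) phi i (dcoord i v) =
    \sum_(i <- [seq i <- r | dcoord i v != 0]) phi i (dcoord i v).
  rewrite big_filter [RHS]big_mkcond; apply: eq_bigr => i _.
  by case: eqP => //= ->; rewrite linear0.
rewrite restrict [RHS]restrict; apply: perm_big; apply: uniq_perm.
- exact: filter_uniq.
- exact: filter_uniq.
move=> i; rewrite !mem_filter; case vi: (dcoord i v != 0) => //=.
by rewrite vs ?vt.
Qed.

(** The support is an arbitrary choice. By [support_sum_eq] the value does not depend on it, which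
    is what linearity needs. *)
Definition copair_def (v : dsum) : M :=
  \sum_(i <- sval (cid (dsum_support v))) phi i (dcoord i v).

Lemma copair_defE v s : uniq s -> (forall i, dcoord i v != 0 -> i \in s) ->
  copair_def v = \sum_(i <- s) phi i (dcoord i v).
Proof.
move=> us vs; rewrite /copair_def; case: cid => t [ut vt] /=.
exact: support_sum_eq.
Qed.

Fact copair_linear : linear copair_def.
Proof.
move=> a v w.
have [s [us vs]] := dsum_support v; have [t [ut wt]] := dsum_support w.
have vr i : dcoord i v != 0 -> i \in undup (s ++ t).
  by rewrite mem_undup mem_cat => /vs ->.
have wr i : dcoord i w != 0 -> i \in undup (s ++ t).
  by rewrite mem_undup mem_cat => /wt ->; rewrite orbT.
rewrite (copair_defE (undup_uniq _) vr) (copair_defE (undup_uniq _) wr).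
rewrite (@copair_defE _ (undup (s ++ t))) ?undup_uniq //; last first.
  move=> i; rewrite linearP; have [v0|/vr //] := eqVneq (dcoord i v) 0.
  by rewrite v0 scaler0 add0r; exact: wr.
rewrite scaler_sumr -big_split; apply: eq_bigr => i _.
by rewrite !linearP.
Qed.
Definition copair : {linear dsum -> M} := mk_linear copair_linear.

Lemma copairE v s : uniq s -> (forall i, dcoord i v != 0 -> i \in s) ->
  copair v = \sum_(i <- s) phi i (dcoord i v).
Proof. exact: copair_defE. Qed.

Lemma copair_single i p : copair (single i p) = phi i p.
Proof.
rewrite (@copairE _ [:: i]) ?big_seq1 ?dcoord_single // => j pj.
by rewrite inE; apply: contraNT pj => ji; rewrite dcoord_single_neq.
Qed.

End Copairing.

Lemma dsum_decomp v s : uniq s -> (forall i, dcoord i v != 0 -> i \in s) ->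
  v = \sum_(i <- s) single i (dcoord i v).
Proof.
move=> us vs; apply: dsum_eq => j; rewrite linear_sum.
have [js|] := boolP (j \in s).
  rewrite (bigD1_seq j) // dcoord_single big1 => [|i ij].
    exact/esym/addr0.
  by apply: dcoord_single_neq; rewrite eq_sym.
move=> /[dup] js; move/(contraNN (vs j)); rewrite negbK => /eqP ->.
rewrite big_seq big1 // => i si; apply: dcoord_single_neq.
by apply: contraNneq js => ->.
Qed.

Lemma dsum_projective : (forall i, projective (P i)) -> projective dsum.
Proof.
move=> P_proj X Y g h g_surj.
have lift i := cid (P_proj i X Y g (h \o single i) g_surj).
pose k i := sval (lift i); have gk i p : g (k i p) = h (single i p).
  by rewrite /k; case: (lift i).
exists (copair k) => v; have [s [us vs]] := dsum_support v.
rewrite (copairE k us vs) linear_sum [in RHS](dsum_decomp us vs) linear_sum.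
by apply: eq_bigr => i _; exact: gk.
Qed.

End DirectSum.
Arguments dcoord {A I P} i.
Arguments single {A I P} i.

(** * Filtrations and projective dimension *)

Section ProjectiveDimension.
Variable A : pzRingType.
Implicit Types K M N P Q X Y : lmodType A.

Definition surj M N (p : M -> N) : Prop := forall y, exists x, p x = y.

Definition short_exact K P M (i : {linear K -> P}) (p : {linear P -> M}) : Prop :=
  [/\ injective i, surj p & forall x, p x = 0 <-> exists z, i z = x].

(** An inductive form of [proj_dim_le], suited to induction on syzygies; [pdle_proj_dim] and
    [proj_dim_pdle] show that the two agree. *)
Fixpoint pdle (d : nat) M : Prop :=
  if d is d'.+1 then
    exists K P (i : {linear K -> P}) (p : {linear P -> M}),
      [/\ projective P, pdle d' K & short_exact i p]
  else projective M.

Definition ker_set P M (p : {linear P -> M}) (x : P) : Prop := p x = 0.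

Fact ker_sub P M (p : {linear P -> M}) : is_submodule (ker_set p).
Proof.
rewrite /ker_set; split=> [|x y px py|a x px].
- exact: linear0.
- by rewrite linearD px py addr0.
by rewrite linearZ /= px scaler0.
Qed.
Definition ker P M (p : {linear P -> M}) : lmodType A :=
  submod_type (Submodule (ker_sub p)).
Definition ker_incl P M (p : {linear P -> M}) : {linear ker p -> P} :=
  @sub_incl A P (Submodule (ker_sub p)).

Lemma ker_exact P M (p : {linear P -> M}) : surj p -> short_exact (ker_incl p) p.
Proof.
move=> p_surj; split=> // [|x]; first exact: sub_incl_inj.
split=> [px|[z <-]]; last exact: (sub_inclP (U := Submodule (ker_sub p))).
by exists (in_sub (U := Submodule (ker_sub p)) px).
Qed.

Lemma pdle_iso d M N (h : {linear M -> N}) :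
  injective h -> surj h -> pdle d M -> pdle d N.
Proof.
case: d => [|d] h_inj h_surj /=; last first.
  move=> [K [P [i [p [P_proj K_pd [i_inj p_surj ip]]]]]].
  exists K, P, i, (h \o p); split=> //; split=> // [y|x].
    by have [z <-] := h_surj y; have [x <-] := p_surj z; exists x.
  rewrite -ip /=; split=> [|->]; last exact: linear0.
  by rewrite -[0](linear0 h) => /h_inj.
have [k hk] : exists k : {linear N -> M}, forall y, h (k y) = y.
  exact: (lift_along_inj (g := idfun : {linear N -> N}) h_inj h_surj).
exact: projective_retract hk.
Qed.

Lemma projective0 M : (forall x : M, x = 0) -> projective M.
Proof.
move=> M0 X Y g h _; exists (\0 : {linear M -> X}) => x.
by rewrite [x]M0 !linear0.
Qed.

Lemma pdle_S d M : pdle d M -> pdle d.+1 M.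
Proof.
elim: d M => [|d IHd] M; last first.
  move=> [K [P [i [p [P_proj K_pd ip]]]]].
  by exists K, P, i, p; split=> //; exact: IHd.
move=> M_proj; exists ('rV[A]_0 : lmodType A), M.
exists (\0 : {linear 'rV[A]_0 -> M}), (idfun : {linear M -> M}); split=> //.
  by apply: projective0 => x; apply/rowP; case.
split=> [x y _|y|x]; first by apply/rowP; case.
  by exists y.
by split=> [/= ->|[z <-] //]; exists 0.
Qed.

Lemma pdle_le d e M : (d <= e)%N -> pdle d M -> pdle e M.
Proof.
move=> /subnKC <-; elim: (e - d)%N => [|k IHk]; rewrite ?addn0 ?addnS //.
by move=> /IHk/pdle_S.
Qed.

Lemma pdle0 d M : (forall x : M, x = 0) -> pdle d M.
Proof. by move=> /projective0; exact: (@pdle_le 0%N). Qed.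

End ProjectiveDimension.

(** * Auslander's lemma for well-ordered filtrations *)

Section Filtrations.
Variables (A : pzRingType) (I : eqType) (lt : I -> I -> Prop).

Section Span.
Variables (M : lmodType A) (N : I -> lmodType A) (iota : forall i, {linear N i -> M}).

Inductive span (D : I -> Prop) : M -> Prop :=
| span0 : span D 0
| span_add i (u : N i) x : D i -> span D x -> span D (iota i u + x).

Lemma span_sub (D : I -> Prop) : is_submodule (span D).
Proof.
split; first exact: span0.
  move=> x y xs; elim: xs y => [|i u z Di _ IH] y ys; first by rewrite add0r.
  by rewrite -addrA; apply: span_add => //; exact: IH.
move=> a x; elim=> [|i u z Di _ IH]; first by rewrite scaler0; exact: span0.
by rewrite scalerDr -linearZ; exact: span_add.
Qed.

Lemma span_single (D : I -> Prop) i (u : N i) : D i -> span D (iota i u).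
Proof. by move=> Di; rewrite -[iota i u]addr0; apply: span_add => //; exact: span0. Qed.

Lemma span_min (D : I -> Prop) (U : submodule M) :
  (forall i u, D i -> U (iota i u)) -> forall x, span D x -> U x.
Proof.
by move=> DU x; elim=> [|i u y Di _ Uy]; [exact: sub0 | apply: subD => //; exact: DU].
Qed.

End Span.

(* A filtration of M indexed by a well-order: the i-th step is the span of the
   images of the N j for j at most i, and Q i is its quotient by the span of the
   images for j < i. *)
Definition filtration (M : lmodType A) (N Q : I -> lmodType A)
    (iota : forall i, {linear N i -> M}) (q : forall i, {linear N i -> Q i}) : Prop :=
  [/\ forall i, surj (q i),
      forall i u, q i u = 0 <-> span iota (lt^~ i) (iota i u) &
      forall x, span iota (fun=> True) x].

Hypothesis lt_wf : well_founded lt.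
Hypothesis lt_trans : forall i j k, lt i j -> lt j k -> lt i k.
Hypothesis lt_total : forall i j, [\/ lt i j, i = j | lt j i].

Lemma lt_irr i : ~ lt i i.
Proof. by by elim: (lt_wf i) => j _ IH ltjj; exact: (IH _ ltjj ltjj). Qed.

Definition le i j : Prop := lt i j \/ i = j.

(** Finite support provides a leading index even if the order has no maximum; kernels are controlled
    through leading coordinates. *)
Lemma max_in_support (P : I -> lmodType A) (v : dsum P) :
  v = 0 \/ exists i, dcoord i v != 0 /\ forall j, dcoord j v != 0 -> le j i.
Proof.
have [s [_ vs]] := dsum_support v.
suff H : (forall j, j \in s -> dcoord j v = 0) \/ exists i,
    [/\ dcoord i v != 0 & forall j, j \in s -> dcoord j v != 0 -> le j i].
  case: H => [v0|[i [vi vmax]]]; last by right; exists i; split=> // j /[dup]/vs/vmax.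
  left; apply: dsum_eq => j; rewrite linear0.
  by have [//|/vs/v0] := eqVneq (dcoord j v) 0.
elim: s {vs} => [|k s IH]; first by left.
have [vk0|vk] := eqVneq (dcoord k v) 0.
  case: IH => [v0|[i [vi vmax]]]; [left|right; exists i; split=> //].
    by move=> j; rewrite inE => /orP[/eqP ->|/v0].
  by move=> j; rewrite inE => /orP[/eqP ->|/vmax //]; rewrite vk0 eqxx.
right; case: IH => [v0|[i [vi vmax]]].
  exists k; split=> // j; rewrite inE => /orP[/eqP -> _|/v0 ->]; first by right.
  by rewrite eqxx.
case: (lt_total k i) => [ki|ki|ik].
- exists i; split=> // j; rewrite inE => /orP[/eqP -> _|/vmax //]; by left.
- by exists i; split=> // j; rewrite inE ki => /orP[/eqP -> _|/vmax //]; right.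
exists k; split=> // j; rewrite inE => /orP[/eqP -> _|js vj]; first by right.
by left; case: (vmax j js vj) => [ji|-> //]; exact: lt_trans ji ik.
Qed.

Section Cover.
Variables (M : lmodType A) (N Q P : I -> lmodType A).
Variables (iota : forall i, {linear N i -> M}) (q : forall i, {linear N i -> Q i}).
Variable (p : forall i, {linear P i -> Q i}).
Hypothesis MNQ : filtration iota q.
Hypothesis P_proj : forall i, projective (P i).
Hypothesis p_surj : forall i, surj (p i).

Definition supp_le i (v : dsum P) : Prop := forall j, dcoord j v != 0 -> le j i.

(** A horseshoe lemma along the order: each [P i] is lifted from [Q i] to [N i], and the lifts are
    added up. The last two clauses say that the leading coordinates at [i] of kernel elements are
    exactly the kernel of [p i], so the kernel is again filtered, by the syzygies of the [Q i]. *)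
Lemma filtration_cover : exists phi : {linear dsum P -> M},
  [/\ surj phi,
      forall i v, supp_le i v -> phi v = 0 -> p i (dcoord i v) = 0 &
      forall i w, p i w = 0 ->
        exists v, [/\ supp_le i v, phi v = 0 & dcoord i v = w]].
Proof.
case: MNQ => q_surj q0 M_span.
have lift i := cid (P_proj (p i) (q_surj i)).
pose l i : {linear P i -> N i} := sval (lift i).
have ql i w : q i (l i w) = p i w by rewrite /l; case: (lift i).
pose phi := copair (fun i => iota i \o l i : {linear P i -> M}).
have phi1 i w : phi (single i w) = iota i (l i w) by exact: copair_single.
have supp_lt_span i v : (forall j, dcoord j v != 0 -> lt j i) ->
    span iota (lt^~ i) (phi v).
  move=> vi; have [s [us vs]] := dsum_support v.
  rewrite /phi (copairE _ us vs).
  have [S0 SD _] := span_sub iota (lt^~ i).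
  elim/big_ind: _ => // j _.
  have [->|/vi ji] := eqVneq (dcoord j v) 0; first by rewrite linear0.
  exact: span_single.
pose B i : M -> Prop := fun x => exists v, supp_le i v /\ phi v = x.
have lift_span i : (forall j, lt j i -> forall u, B j (iota j u)) ->
    forall x, span iota (lt^~ i) x ->
    exists v, (forall j, dcoord j v != 0 -> lt j i) /\ phi v = x.
  move=> IH; have lt_sub : is_submodule (fun x =>
      exists v, (forall j, dcoord j v != 0 -> lt j i) /\ phi v = x).
    split; first by exists 0; split=> [j|]; rewrite linear0 // eqxx.
      move=> x y [v [vi <-]] [v' [vi' <-]]; exists (v + v'); rewrite linearD.
      split=> // j; rewrite linearD; have [->|/vi //] := eqVneq (dcoord j v) 0.
      by rewrite add0r; exact: vi'.
    move=> a x [v [vi <-]]; exists (a *: v); rewrite linearZ; split=> // j.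
    have -> : dcoord j (a *: v) = a *: dcoord j v by [].
    by move=> avj; apply: vi; apply: contraNneq avj => ->; rewrite scaler0.
  apply: (span_min (U := Submodule lt_sub)) => j u ji /=.
  have [v [vj phiv]] := IH j ji u; exists v; split=> // k /vj[kj|-> //].
  exact: lt_trans kj ji.
(* Well-founded induction: subtracting a lift of [q i u] moves [u] into the span of the earlier
   steps, which is already covered. *)
have B_iota i u : B i (iota i u).
  elim: (lt_wf i) u => {}i _ IH u.
  have [w pw] := p_surj (q i u).
  have /(lift_span i IH)[v [vi phiv]] : span iota (lt^~ i) (iota i (u - l i w)).
    by apply/q0; rewrite linearB ql pw subrr.
  exists (v + single i w); split; last first.
    by rewrite linearD phiv phi1 linearB subrK.
  move=> j; rewrite linearD; have [->|ij] := eqVneq j i; first by right.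
rewrite dcoord_single_neq // addr0 =>  vj; left; exact: vi.
exists phi; split.
- have im_sub : is_submodule (fun x => exists v, phi v = x).
    split; first by exists 0; rewrite linear0.
      by move=> _ _ [v <-] [w <-]; exists (v + w); rewrite linearD.
    by move=> a _ [v <-]; exists (a *: v); rewrite linearZ.
  move=> x; apply: (span_min (U := Submodule im_sub)) (M_span x) => i u _.
  by have [v [_ <-]] := B_iota i u; exists v.
- move=> i v vi phiv; rewrite -ql; apply/q0.
  have := supp_lt_span i (v - single i (dcoord i v)).
  rewrite linearB phiv phi1 sub0r => H.
  have [_ _ SZ] := span_sub iota (lt^~ i).
  rewrite -[iota _ _]opprK -scaleN1r; apply/SZ/H => j.
  rewrite linearB; have [->|ij] := eqVneq j i.
    by rewrite dcoord_single subrr eqxx.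
  rewrite dcoord_single_neq // subr0 => /vi[//|ji].
  by rewrite ji eqxx in ij.
move=> i w pw.
have : span iota (lt^~ i) (iota i (l i w)) by apply/q0; rewrite ql.
move=> /(lift_span i (fun j _ => B_iota j))[v [vi phiv]].
exists (single i w - v); split.
- move=> j; rewrite linearB; have [->|ij] := eqVneq j i; first by right.
  rewrite dcoord_single_neq // sub0r oppr_eq0 => vj; left; exact: vi.
- by rewrite linearB phi1 phiv subrr.
rewrite linearB dcoord_single; have [->|/vi/lt_irr//] := eqVneq (dcoord i v) 0.
exact: subr0.
Qed.

End Cover.

(** Induction on [d]: the kernel of the cover is filtered by the syzygies [K i]. For [d = 0] each
    [Q i] covers itself, and then a nonzero kernel element would have a leading coordinate both zero
    and nonzero. *)
Lemma filtration_pdle d (M : lmodType A) (N Q : I -> lmodType A)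
    (iota : forall i, {linear N i -> M}) (q : forall i, {linear N i -> Q i}) :
  filtration iota q -> (forall i, pdle d (Q i)) -> pdle d M.
Proof.
elim: d M N Q iota q => [|d IHd] M N Q iota q MNQ Q_pd.
  have [i|phi [phi_surj phi0 _]] :=
      filtration_cover (p := fun i => (idfun : {linear Q i -> Q i})) MNQ Q_pd.
    by move=> y; exists y.
  apply: (pdle_iso (d := 0) (h := phi)) (dsum_projective Q_pd) => // v w vw.
  apply/eqP; rewrite -subr_eq0; apply/eqP.
  have [//|[i [vwi vw_le]]] := max_in_support (v - w).
  have := phi0 i (v - w) vw_le; rewrite linearB vw subrr => /(_ erefl) H.
  by case/eqP: vwi; exact: H.
pose K i : lmodType A := sval (cid (Q_pd i)).
have K_spec i : exists (P : lmodType A) (k : {linear K i -> P}) (p : {linear P -> Q i}),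
    [/\ projective P, pdle d (K i) & short_exact k p].
  by rewrite /K; case: cid.
pose P i : lmodType A := sval (cid (K_spec i)).
have P_spec i : exists (k : {linear K i -> P i}) (p : {linear P i -> Q i}),
    [/\ projective (P i), pdle d (K i) & short_exact k p].
  by rewrite /P; case: cid.
pose k i : {linear K i -> P i} := sval (cid (P_spec i)).
have k_spec i : exists p : {linear P i -> Q i},
    [/\ projective (P i), pdle d (K i) & short_exact (k i) p].
  by rewrite /k; case: cid.
pose p i : {linear P i -> Q i} := sval (cid (k_spec i)).
have p_spec i : [/\ projective (P i), pdle d (K i) & short_exact (k i) (p i)].
  by rewrite /p; case: cid.
have P_proj i : projective (P i) by case: (p_spec i).
have p_surj i : surj (p i) by case: (p_spec i) => _ _ [].
have [phi [phi_surj phi0 phi1]] := filtration_cover MNQ P_proj p_surj.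
exists (ker phi), (dsum P), (ker_incl phi), phi; split=> //; last exact: ker_exact.
  exact: dsum_projective.
have step_sub i : is_submodule (fun v : dsum P => supp_le i v /\ phi v = 0).
  split; first by split; rewrite ?linear0 // => j; rewrite linear0 eqxx.
    move=> v w [vi v0] [wi w0]; split; last by rewrite linearD v0 w0 addr0.
    move=> j; rewrite linearD; have [->|/vi //] := eqVneq (dcoord j v) 0.
    by rewrite add0r; exact: wi.
  move=> a v [vi v0]; split; last by rewrite linearZ /= v0 scaler0.
  move=> j; have -> : dcoord j (a *: v) = a *: dcoord j v by [].
  by move=> avj; apply: vi; apply: contraNneq avj => ->; rewrite scaler0.
(* The i-th step of the filtration of the syzygy consists of the kernel elements supported at
   indices up to [i]; [q'] reads off the leading coordinate. *)
pose N' i : lmodType A := submod_type (Submodule (step_sub i)).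
pose incl i : {linear N' i -> dsum P} := @sub_incl A _ (Submodule (step_sub i)).
have N'P i (u : N' i) : supp_le i (incl i u) /\ phi (incl i u) = 0.
  exact: (sub_inclP (U := Submodule (step_sub i))).
have iota'_ex i : exists h : {linear N' i -> ker phi},
    forall u, ker_incl phi (h u) = incl i u.
  apply: lift_along_inj; first exact: sub_incl_inj.
  move=> u; have [_ u0] := N'P i u.
  by exists (in_sub (U := Submodule (ker_sub phi)) u0).
pose iota' i := sval (cid (iota'_ex i)).
have iota'E i u : ker_incl phi (iota' i u) = incl i u.
  by rewrite /iota'; case: cid.
have q'_ex i : exists h : {linear N' i -> K i},
    forall u, k i (h u) = dcoord i (incl i u).
  have [_ _ [k_inj _ kp]] := p_spec i.
  apply: (lift_along_inj (g := dcoord i \o incl i : {linear _ -> _})) k_inj _ => u.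
  by apply/kp; have [ui u0] := N'P i u; exact: phi0.
pose q' i := sval (cid (q'_ex i)).
have q'E i u : k i (q' i u) = dcoord i (incl i u) by rewrite /q'; case: cid.
have iota'_in i (v : ker phi) : supp_le i (ker_incl phi v) ->
    exists u, iota' i u = v.
  move=> vi; have v0 : phi (ker_incl phi v) = 0.
    exact: (sub_inclP (U := Submodule (ker_sub phi))).
  exists (in_sub (U := Submodule (step_sub i)) (conj vi v0)).
  by apply: sub_incl_inj; exact: iota'E.
apply: (IHd _ N' K iota' q'); last by move=> i; case: (p_spec i).
split.
- move=> i y; have [_ _ [k_inj _ kp]] := p_spec i.
  have [|v [vi v0 vy]] := phi1 i (k i y); first by apply/kp; exists y.
  exists (in_sub (U := Submodule (step_sub i)) (conj vi v0)).
  by apply: k_inj; rewrite q'E.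
- move=> i u; have [_ _ [k_inj _ _]] := p_spec i; split=> [qu0|].
    have ui : dcoord i (incl i u) = 0 by rewrite -q'E qu0 linear0.
    have [u0|[j [uj u_le]]] := max_in_support (incl i u).
      have -> : iota' i u = 0; last exact: span0.
      by apply: sub_incl_inj; rewrite [LHS]iota'E u0.
    have [|u' <-] := iota'_in j (iota' i u); first by rewrite iota'E.
    apply: span_single; have [/(_ j uj)[//|ji] _] := N'P i u.
    by case/eqP: uj; rewrite ji.
  move=> u_span; apply: k_inj; rewrite q'E linear0 -iota'E.
  move: u_span; apply: (span_min (U := Submodule
    (ker_sub (dcoord i \o ker_incl phi : {linear ker phi -> P i})))) => j v ji.
  rewrite /= /ker_set /= iota'E; have [v_le _] := N'P j v.
  have [//|/v_le[ij|ij]] := eqVneq (dcoord i (incl j v)) 0.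
    by case: (lt_irr (lt_trans ij ji)).
  by case: (@lt_irr i); rewrite {1}ij.
move=> v; have [v0|[i [_ v_le]]] := max_in_support (ker_incl phi v).
  have -> : v = 0 by apply: sub_incl_inj; rewrite -/(ker_incl phi v) v0 linear0.
  exact: span0.
have [u <-] := iota'_in i v v_le; exact: span_single.
Qed.
End Filtrations.

(** The well-ordering principle supplies a relation for which every nonempty set has a unique
    minimum. Sets of at most three elements yield the order axioms, and the set of non-accessible
    elements yields well-foundedness. *)
Lemma strict_well_order (T : eqType) : exists lt : T -> T -> Prop,
  [/\ well_founded lt, forall i j k, lt i j -> lt j k -> lt i k &
      forall i j, [\/ lt i j, i = j | lt j i]].
Proof.
have [R R_wo] := well_ordering_principle T.
have min_of (a b c : T) : exists z, [/\ z \in [:: a; b; c], R z a, R z b & R z c].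
  have [|z [[zA z_min] _]] := R_wo (mem [:: a; b; c]).
    by exists a; rewrite !inE eqxx.
  by exists z; split=> //; apply: z_min; rewrite !inE eqxx ?orbT.
have R_refl x : R x x.
  by have [z [+ + _ _]] := min_of x x x; rewrite !inE => /or3P[] /eqP ->.
have R_total x y : R x y \/ R y x.
  by have [z [+ + + _]] := min_of x y y; rewrite !inE => /or3P[] /eqP ->; auto.
have R_anti x y : R x y -> R y x -> x = y.
  move=> xy yx; have [|z [_ z_uniq]] := R_wo (mem [:: x; y]).
    by exists x; rewrite !inE eqxx.
  transitivity z; [symmetry|]; apply: z_uniq.
    by split=> [|w]; rewrite !inE ?eqxx // => /orP[] /eqP ->.
  by split=> [|w]; rewrite !inE ?eqxx ?orbT // => /orP[] /eqP ->.
have R_trans x y w : R x y -> R y w -> R x w.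
  move=> xy yw; have [z [+ zx zy zw]] := min_of x y w.
  rewrite !inE => /or3P[] /eqP ez.
  - by rewrite -ez.
  - by rewrite (R_anti x y) // -ez.
  by rewrite (R_anti w y) // -ez.
exists (fun x y => R x y /\ x <> y); split.
- move=> x; apply: contrapT => nAx.
  have [|z [[zA z_min] _]] :=
    R_wo [pred x | ~~ `[< Acc (fun x y => R x y /\ x <> y) x >]].
    by exists x; apply/asboolPn.
  move: zA; rewrite inE => /asboolPn; apply; constructor=> y [yz ne].
  apply: contrapT => nAy; apply: ne; apply: R_anti => //.
  by apply: z_min; rewrite inE; apply/asboolPn.
- move=> x y w [xy ne] [yw ne']; split; first exact: R_trans yw.
  by move=> xw; apply: ne; apply: R_anti => //; rewrite xw.
move=> x y; have [->|ne] := pselect (x = y); first by constructor 2.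
case: (R_total x y) => [xy|yx]; first by constructor 1.
by constructor 3; split=> // yx'; apply: ne.
Qed.

(** * Cyclic modules, extensions, cokernels and syzygies *)

Section ProjectiveDimensionTheory.
Variable A : pzRingType.
Implicit Types K M N P Q X Y : lmodType A.

Fact act_linear M (x : M) : linear (fun a : A^o => (a : A) *: x).
Proof. by move=> a b c; rewrite scalerDl scalerA. Qed.
Definition act M (x : M) : {linear A^o -> M} := mk_linear (act_linear x).

(* Auslander's reduction of the projective dimension of M to cyclic modules. *)
Lemma pdle_generated d (I : eqType) M (x : I -> M) :
  (forall y, span (fun i => act (x i)) (fun=> True) y) ->
  (forall i (U : submodule A^o), (forall a, a *: x i = 0 -> U a) ->
     pdle d (quotmod U)) ->
  pdle d M.
Proof.
move=> M_gen Q_pd; have [lt [lt_wf lt_trans lt_total]] := strict_well_order I.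
(* The i-th factor of the filtration is cyclic, generated by the class of [x i]; its annihilator
   consists of the [a] that send [x i] into the span of the earlier generators. *)
have step_sub i : is_submodule (fun a : A^o =>
    span (fun i => act (x i)) (lt^~ i) (act (x i) a)).
  have [s0 sD sZ] := span_sub (fun i => act (x i)) (lt^~ i).
  split=> [|a b sa sb|a b sb]; first by rewrite linear0.
    by rewrite linearD; exact: sD.
  by rewrite linearZ; exact: sZ.
pose U i := Submodule (step_sub i).
apply: (filtration_pdle lt_wf lt_trans lt_total
  (N := fun=> A^o) (Q := fun i => quotmod (U i)) (iota := fun i => act (x i))
  (q := fun i => quotmod_pi (U i))) => [|i].
  split=> // [i y|i a]; first exact: quotmod_pi_surj.
  exact: (quotmod_pi_eq0 (U i) a).
apply: (Q_pd i) => a ax0; rewrite /= ax0; exact: span0.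
Qed.

(** A short exact sequence is a filtration with two steps, indexed by [false] before [true], so the
    filtration lemma applies. *)
Lemma pdle_extension d K M Q (i : {linear K -> M}) (p : {linear M -> Q}) :
  short_exact i p -> pdle d K -> pdle d Q -> pdle d M.
Proof.
move=> [i_inj p_surj ip] K_pd Q_pd.
pose lt b c := b = false /\ c = true.
pose N (b : bool) : lmodType A := if b then M else K.
pose F (b : bool) : lmodType A := if b then Q else K.
pose iota b : {linear N b -> M} :=
  if b is true then (idfun : {linear M -> M}) else i.
pose q b : {linear N b -> F b} :=
  if b is true then p else (idfun : {linear K -> K}).
have noF x : ~ lt x false by case.
apply: (filtration_pdle (lt := lt) _ _ _ (N := N) (Q := F) (iota := iota) (q := q)).
- have accF : Acc lt false by constructor=> b /noF.
  by case; [constructor=> b [-> _]; exact: accF | exact: accF].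
- by move=> b c e [_ ->] [].
- by case=> [] []; [constructor 2|constructor 3|constructor 1|constructor 2].
- split.
  + by case=> y /=; [exact: p_surj | exists y].
  + case=> u.
      rewrite ip; split=> [[z <-]|].
        by apply: (span_single iota (i := false)).
      have im_sub : is_submodule (fun u => exists z, i z = u).
        split; first by exists 0; rewrite linear0.
          by move=> _ _ [v <-] [w <-]; exists (v + w); rewrite linearD.
        by move=> a _ [v <-]; exists (a *: v); rewrite linearZ.
      apply: (span_min (U := Submodule im_sub)) => -[] v [] //= _ _.
      by exists v.
    split=> [/= ->|]; first by rewrite linear0; exact: span0.
    move=> iu; apply: i_inj; rewrite linear0.
    have zero_sub : is_submodule (fun u : M => u = 0).
      by split=> // [x y -> ->|a x ->]; rewrite ?addr0 ?scaler0.
    by move: iu; apply: (span_min (U := Submodule zero_sub)) => j v /noF.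
  by move=> y; apply: (span_single iota (i := true)).
by case.
Qed.

(** A projective cover of M also covers Q, and its kernel over Q is an extension of K by the syzygy
    of M, both of dimension at most [d]. *)
Lemma pdle_cokernel d K M Q (i : {linear K -> M}) (p : {linear M -> Q}) :
  short_exact i p -> pdle d K -> pdle d.+1 M -> pdle d.+1 Q.
Proof.
move=> [i_inj p_surj ip] K_pd [L [P [l [q [P_proj L_pd [l_inj q_surj lq]]]]]].
pose pi : {linear P -> Q} := p \o q.
have pi_surj : surj pi.
  by move=> y; have [x <-] := p_surj y; have [z <-] := q_surj x; exists z.
exists (ker pi), P, (ker_incl pi), pi; split=> //; last exact: ker_exact.
have [incl_inj _ incl_pi] := ker_exact pi_surj.
have [g gE] : exists g : {linear ker pi -> K}, forall x, i (g x) = q (ker_incl pi x).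
  apply: (lift_along_inj (g := q \o ker_incl pi : {linear _ -> _})) => // x.
  by apply/ip; apply: (incl_pi (ker_incl pi x)).2; exists x.
have [j jE] : exists j : {linear L -> ker pi}, forall x, ker_incl pi (j x) = l x.
  apply: lift_along_inj => // x; apply/incl_pi.
  by rewrite /pi /= (lq (l x)).2 ?linear0 //; exists x.
apply: (pdle_extension (i := j) (p := g)) => //; split.
- by move=> x y xy; apply: l_inj; rewrite -!jE xy.
- move=> y; have [x qx] := q_surj (i y).
  have [|z zx] := (incl_pi x).1; first by rewrite /pi /= qx; apply/ip; exists y.
  by exists z; apply: i_inj; rewrite gE zx.
move=> x; split=> [gx|[z <-]].
  have [|z lz] := (lq (ker_incl pi x)).1; first by rewrite -gE gx linear0.
  by exists z; apply: incl_inj; rewrite jE.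
apply: i_inj; rewrite gE jE linear0; apply/lq; by exists z.
Qed.

(* The pullback of two projective covers of M is an extension of each of them by
   the kernel of the other. *)
Lemma pdle_syzygy d K P K' P' M (i : {linear K -> P}) (p : {linear P -> M})
    (i' : {linear K' -> P'}) (p' : {linear P' -> M}) :
  short_exact i p -> short_exact i' p' -> projective P -> projective P' ->
  pdle d K' -> pdle d K.
Proof.
move=> [i_inj p_surj ip] [i'_inj p'_surj ip'] P_proj P'_proj K'_pd.
pose PP : lmodType A := (P * P')%type.
have diff_lin : linear (fun x : PP => p x.1 - p' x.2).
  move=> a x y.
  have -> : (a *: x + y).1 = a *: x.1 + y.1 by [].
  have -> : (a *: x + y).2 = a *: x.2 + y.2 by [].
  rewrite (linearD p) (linearD p') !linearZ /= opprD.
  by rewrite addrACA scalerBr.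
pose diff : {linear PP -> M} := mk_linear diff_lin.
pose incl := ker_incl diff.
have inclP x : p (incl x).1 = p' (incl x).2.
  apply/eqP; rewrite -subr_eq0; apply/eqP.
  exact: (sub_inclP (U := Submodule (ker_sub diff))).
have incl_in (x : PP) : p x.1 = p' x.2 -> exists y, incl y = x.
  move=> px; have x0 : diff x = 0 by rewrite /= px subrr.
  by exists (in_sub (U := Submodule (ker_sub diff)) x0).
have incl_inj : injective incl by exact: sub_incl_inj.
have f1_lin : linear (fun x => (incl x).1) by move=> a x y; rewrite linearP.
have f2_lin : linear (fun x => (incl x).2) by move=> a x y; rewrite linearP.
have [f1 f1E] : exists h : {linear ker diff -> P}, forall x, h x = (incl x).1.
  by exists (mk_linear f1_lin).
have [f2 f2E] : exists h : {linear ker diff -> P'}, forall x, h x = (incl x).2.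
  by exists (mk_linear f2_lin).
have f1_surj : surj f1.
  move=> y; have [y' py'] := p'_surj (p y).
  by have [x xE] := incl_in (y, y') (esym py'); exists x; rewrite f1E xE.
have f2_surj : surj f2.
  move=> y; have [y' py'] := p_surj (p' y).
  by have [x xE] := incl_in (y', y) py'; exists x; rewrite f2E xE.
have in2_lin : linear (fun k => (0, i' k) : PP).
  by move=> a x y; rewrite linearP; congr pair; rewrite /= scaler0 addr0.
have in1_lin : linear (fun k => (i k, 0) : PP).
  by move=> a x y; rewrite linearP; congr pair; rewrite /= scaler0 addr0.
have [j' j'E] : exists j : {linear K' -> ker diff}, forall k, incl (j k) = (0, i' k).
  apply: (lift_along_inj (g := mk_linear in2_lin)) => // k.
  by apply: incl_in; rewrite /= linear0 (ip' (i' k)).2 //; exists k.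
have [j jE] : exists j : {linear K -> ker diff}, forall k, incl (j k) = (i k, 0).
  apply: (lift_along_inj (g := mk_linear in1_lin)) => // k.
  by apply: incl_in; rewrite /= linear0 (ip (i k)).2 //; exists k.
have X_pd : pdle d (ker diff).
  apply: (pdle_extension (i := j') (p := f1)) => //; last exact: (@pdle_le _ 0%N).
  split=> // [x y xy|x]; first by apply: i'_inj; have := j'E x; rewrite xy j'E => -[].
  split=> [x1|[z <-]]; last by rewrite f1E j'E.
  have /ip'[z zE] : p' (incl x).2 = 0.
    by rewrite -inclP -f1E x1 linear0.
  exists z; apply: incl_inj; rewrite j'E zE [RHS]surjective_pairing.
  by congr pair; rewrite -f1E.
(* The pullback splits over the projective P', so it is the sum of P' and K: for [d = 0] K is a
   retract of it, and otherwise K is the cokernel of the section [s]. *)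
have [s f2s] := P'_proj _ _ f2 (idfun : {linear P' -> P'}) f2_surj.
have [r rE] : exists r : {linear ker diff -> K},
    forall x, i (r x) = f1 (x - s (f2 x)).
  pose g : {linear ker diff -> P} := f1 \o (idfun \- (s \o f2)).
  apply: (lift_along_inj (g := g)) => // x.
  by apply/ip; rewrite /= f1E inclP -f2E linearB f2s subrr linear0.
have rj k : r (j k) = k.
  apply: i_inj; rewrite rE.
  have -> : f2 (j k) = 0 by rewrite f2E jE.
  by rewrite linear0 subr0 f1E jE.
case: d K'_pd X_pd => [|d] K'_pd X_pd; first exact: projective_retract X_pd.
apply: (pdle_cokernel (i := s) (p := r)) X_pd; last exact: (@pdle_le _ 0%N).
split=> [x y xy|k|x]; first by rewrite -[x]f2s -[y]f2s xy.
  by exists (j k).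
split=> [rx|[y <-]].
  exists (f2 x); apply/eqP; rewrite eq_sym -subr_eq0; apply/eqP.
  apply: incl_inj; rewrite linear0 [LHS]surjective_pairing.
  congr pair; first by have := rE x; rewrite rx linear0 f1E.
  by rewrite -f2E linearB f2s subrr.
by apply: i_inj; rewrite rE f2s subrr !linear0.
Qed.

Lemma pdle_proj_dim d M : pdle d M -> proj_dim_le M d.
Proof.
elim: d M => [|d IHd] M.
  move=> M_proj; pose P k : lmodType A := if k is 0%N then M else 'rV[A]_0.
  have P0 k (x : P k.+1) : x = 0 by apply/rowP; case.
  exists P, (fun k => \0 : {linear P k.+1 -> P k}), (idfun : {linear P 0%N -> M}).
  split=> //.
  + by case=> // k; exact: projective0.
  + by move=> y; exists y.
  + by move=> x; split=> [/= ->|[z <-] //]; exists 0.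
  + by move=> k x; split=> // _; exists 0; rewrite [RHS]P0.
  by case=> // k _ x; exact: P0.
move=> [K [P [i [p [P_proj]]]]].
move=> /IHd[P' [del [eps [P'_proj eps_surj eps_ex del_ex P'0]]]] [i_inj p_surj ip].
pose R k : lmodType A := if k is k'.+1 then P' k' else P.
pose del' k : {linear R k.+1 -> R k} :=
  match k with 0%N => i \o eps | k'.+1 => del k' end.
exists R, del', p; split=> //.
- by case.
- move=> x; rewrite ip; split=> [[z <-]|[z <-]]; last by exists (eps z).
  by have [y <-] := eps_surj z; exists y.
- case=> [|k] x /=; last exact: del_ex.
  rewrite -eps_ex; split=> [|->]; last exact: linear0.
  by rewrite -[0](linear0 i) => /i_inj.
by case=> // k kd; exact: P'0.
Qed.

Lemma proj_dim_pdle d M : proj_dim_le M d -> pdle d M.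
Proof.
elim: d M => [|d IHd] M [P [del [eps [P_proj eps_surj eps_ex del_ex P0]]]].
  apply: (pdle_iso (d := 0) (h := eps)) (P_proj 0%N) => // x y xy.
  have /eps_ex[z zxy] : eps (x - y) = 0 by rewrite linearB xy subrr.
  by apply/eqP; rewrite -subr_eq0 -zxy [z]P0 // linear0.
exists (ker eps), (P 0%N), (ker_incl eps), eps; split=> //; last exact: ker_exact.
have [incl_inj _ inclP] := ker_exact eps_surj.
have [e eE] : exists e : {linear P 1%N -> ker eps},
    forall x, ker_incl eps (e x) = del 0%N x.
  apply: lift_along_inj => // x; apply/inclP/eps_ex; by exists x.
apply: IHd; exists (fun k => P k.+1), (fun k => del k.+1), e; split=> //.
- move=> y; have /eps_ex[z zE] : eps (ker_incl eps y) = 0 by apply/inclP; exists y.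
  by exists z; apply: incl_inj; rewrite eE.
- move=> x; rewrite -del_ex -eE; split=> [->|]; first exact: linear0.
  by rewrite -[0](linear0 (ker_incl eps)) => /incl_inj.
by move=> k kd; exact: P0.
Qed.

End ProjectiveDimensionTheory.

(** * The double quiver algebra *)

Section LeftIdeals.
Variable A : pzRingType.
Implicit Types (U V : submodule (A^o : lmodType A)) (c r : A).

Notation left_ideal := (submodule (A^o : lmodType A)).

Lemma submodule_eq U V : (forall r, U r <-> V r) -> U = V.
Proof.
move=> UV; have {UV} : sub_set U = sub_set V.
  by apply: functional_extensionality_dep => r; apply/propext/UV.
case: U V => [U U_sub] [V V_sub] /= UV; case: V / UV V_sub => V_sub.
by rewrite (Prop_irrelevance U_sub V_sub).
Qed.

Lemma idealM U c r : U r -> U (c * r).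
Proof. exact: (@subZ _ _ U c r). Qed.

Lemma idealBr U r r' : U (r - r') -> U r' -> U r.
Proof. by move=> Urr' /(subD Urr'); rewrite subrK. Qed.

Fact annihilator_sub c : is_submodule (fun r : A^o => (r : A) * c = 0).
Proof.
split=> [|r r' rc r'c|a r rc]; first exact: mul0r.
  by rewrite mulrDl rc r'c addr0.
by rewrite -mulrA rc mulr0.
Qed.
Definition annihilator c : left_ideal := Submodule (annihilator_sub c).

Fact colon_sub U c : is_submodule (fun r : A^o => U ((r : A) * c)).
Proof.
split=> [|r r' Ur Ur'|a r Ur]; first by rewrite mul0r; exact: sub0.
  by rewrite mulrDl; exact: subD.
by rewrite -mulrA; exact: idealM.
Qed.
Definition colon U c : left_ideal := Submodule (colon_sub U c).

Fact adjoin_sub U c : is_submodule (fun r : A^o => exists a : A, U ((r : A) - a * c)).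
Proof.
split=> [|r r' [a Ur] [a' Ur']|a r [a' Ur]].
- by exists 0; rewrite mul0r subr0; exact: sub0.
- by exists (a + a'); rewrite mulrDl opprD addrACA; exact: subD.
by exists (a * a'); rewrite -mulrA -mulrBr; exact: idealM.
Qed.
Definition adjoin U c : left_ideal := Submodule (adjoin_sub U c).

Lemma adjoin_le U c r : U r -> adjoin U c r.
Proof. by exists 0; rewrite mul0r subr0. Qed.

Lemma adjoin_mem U c a : adjoin U c (a * c).
Proof. by exists a; rewrite subrr; exact: sub0. Qed.

(** Right multiplication by [c] identifies A/(U : c) with the submodule of A/U generated by the
    class of [c]. *)
Lemma colon_adjoin_exact U c :
  exists (i : {linear quotmod (colon U c) -> quotmod U})
         (p : {linear quotmod U -> quotmod (adjoin U c)}), short_exact i p.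
Proof.
pose g : {linear A^o -> quotmod U} := quotmod_pi U \o act (c : A^o).
have [i iE] : exists i : {linear quotmod (colon U c) -> quotmod U},
    forall r, i (quotmod_pi (colon U c) r) = g r.
  apply: (factor_through_surj (q := quotmod_pi (colon U c))).
    exact: quotmod_pi_surj.
  by move=> r /quotmod_pi_eq0 Ur; apply/quotmod_pi_eq0.
have [p pE] : exists p : {linear quotmod U -> quotmod (adjoin U c)},
    forall r, p (quotmod_pi U r) = quotmod_pi (adjoin U c) r.
  apply: (factor_through_surj (q := quotmod_pi U) (g := quotmod_pi (adjoin U c))).
    exact: quotmod_pi_surj.
  by move=> r /quotmod_pi_eq0 Ur; apply/quotmod_pi_eq0/adjoin_le.
exists i, p; split.
- move=> x y xy; apply/eqP; rewrite -subr_eq0; apply/eqP.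
  have : i (x - y) = 0 by rewrite linearB xy subrr.
  have [r <-] := quotmod_pi_surj (x - y); rewrite iE => /quotmod_pi_eq0 Ur.
  exact/quotmod_pi_eq0.
- by move=> y; have [r <-] := quotmod_pi_surj y; exists (quotmod_pi U r).
move=> x; have [r <-] := quotmod_pi_surj x; rewrite pE quotmod_pi_eq0.
split=> [[a Ura]|[z]].
  by exists (quotmod_pi (colon U c) a); rewrite iE; apply/esym/quotmod_eq.
have [a <-] := quotmod_pi_surj z; rewrite iE => /esym/quotmod_eq Ura.
by exists a.
Qed.

Lemma ideal_pdle_extension d U c :
  pdle d (quotmod (colon U c)) -> pdle d (quotmod (adjoin U c)) ->
  pdle d (quotmod U).
Proof. by have [i [p ip]] := colon_adjoin_exact U c; exact: pdle_extension ip. Qed.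

Lemma ideal_pdle_cokernel d U c :
  pdle d (quotmod (colon U c)) -> pdle d.+1 (quotmod U) ->
  pdle d.+1 (quotmod (adjoin U c)).
Proof. by have [i [p ip]] := colon_adjoin_exact U c; exact: pdle_cokernel ip. Qed.

Lemma unit_ideal_pdle d U : U 1 -> pdle d (quotmod U).
Proof.
move=> U1; apply: pdle0 => x; have [r <-] := quotmod_pi_surj x.
by apply/quotmod_pi_eq0; rewrite -[r]mulr1; exact: (@idealM U r).
Qed.

(** The quotient is isomorphic to the summand A c of A, by right multiplication by [c]; modulo the
    annihilator, r c and r coincide. *)
Lemma idempotent_projective c : c * c = c -> pdle 0 (quotmod (annihilator c)).
Proof.
move=> cc.
have [i iE] : exists i : {linear quotmod (annihilator c) -> A^o},
    forall r, i (quotmod_pi (annihilator c) r) = act (c : A^o) r.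
  apply: (factor_through_surj (q := quotmod_pi (annihilator c)) (g := act (c : A^o))).
    exact: quotmod_pi_surj.
  by move=> r /quotmod_pi_eq0.
apply: (projective_retract (i := i) (p := quotmod_pi (annihilator c))).
  move=> x; have [r <-] := quotmod_pi_surj x; rewrite iE.
  by apply/quotmod_eq; rewrite /= mulrBl -mulrA cc subrr.
exact: projective_regular.
Qed.

End LeftIdeals.

(** * Axioms for the curves and for the algebra, and its modules Delta_k and E_k *)

Section DoubleQuiver.
Variables (S : comNzRingType) (m : S -> Prop) (n : nat) (F t : nat -> S).

(* (S, m) is a local domain, and S/(F k) is a discrete valuation ring with
   uniformizer t k. *)
Record curve_system : Prop := CurveSystem {
  cs_ideal : is_ideal m;
  cs_local : forall x, m x \/ exists u, u * x = 1;
  cs_proper : ~ m 1;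
  cs_max : forall k, (k < n)%N -> forall x, m x <-> exists a b, x = a * F k + b * t k;
  cs_domain : forall x y : S, x * y = 0 -> x = 0 \/ y = 0;
  cs_prime : forall k, (k < n)%N -> prime_element (F k);
  cs_unif : forall k, (k < n)%N -> ~ divides (F k) (t k);
  cs_dvr : forall k, (k < n)%N -> forall x, ~ divides (F k) x ->
    exists u N c, u * x = t k ^+ N + c * F k;
  cs_coprime : forall i j, (i < n)%N -> (j < n)%N -> i <> j -> ~ divides (F i) (F j)
}.

Definition G k : S := \prod_(l < k.+1) F l.

Section Paths.
Variables (A : pzRingType) (e a b : nat -> A).

Fixpoint up_path k d : A := if d is d'.+1 then b (k + d') * up_path k d' else e k.
Fixpoint down_path k d : A :=
  if d is d'.+1 then down_path k d' * a (k + d') else e k.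

End Paths.

(* The double quiver 0 <-> 1 <-> ... <-> n-1, with arrows b k : k -> k+1 and
   a k : k+1 -> k, both composites being multiplication by F (k+1).  The vertex k
   stands for the summand S/(G k), b k for multiplication by F (k+1) and a k for
   the projection; the axioms are invariant under A |-> A^c, a <-> b. *)
Record double_quiver (A : pzRingType) (sigma : S -> A) (e a b : nat -> A) : Prop :=
  DoubleQuiver {
  dq_sigmaD : forall x y, sigma (x + y) = sigma x + sigma y;
  dq_sigmaM : forall x y, sigma (x * y) = sigma x * sigma y;
  dq_sigma1 : sigma 1 = 1;
  dq_central : forall x r, sigma x * r = r * sigma x;
  dq_idem : forall k, (k < n)%N -> e k * e k = e k;
  dq_sum : \sum_(k < n) e k = 1;
  dq_ea : forall k, (k.+1 < n)%N -> e k * a k = a k;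
  dq_ae : forall k, (k.+1 < n)%N -> a k * e k.+1 = a k;
  dq_eb : forall k, (k.+1 < n)%N -> e k.+1 * b k = b k;
  dq_be : forall k, (k.+1 < n)%N -> b k * e k = b k;
  dq_ab : forall k, (k.+1 < n)%N -> a k * b k = sigma (F k.+1) * e k;
  dq_ba : forall k, (k.+1 < n)%N -> b k * a k = sigma (F k.+1) * e k.+1;
  dq_zero : forall k x, (k < n)%N -> sigma x * e k = 0 <-> divides (G k) x;
  dq_up : forall k d r, (k + d < n)%N ->
    exists x, e (k + d)%N * r * e k = sigma x * up_path e b k d;
  dq_down : forall k d r, (k + d < n)%N ->
    exists x, e k * r * e (k + d)%N = sigma x * down_path e a k d
}.

Hypothesis CS : curve_system.
Variables (A : pzRingType) (sigma : S -> A) (e a b : nat -> A).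
Hypothesis DQ : double_quiver sigma e a b.

Local Notation sigmaD := (dq_sigmaD DQ).
Local Notation sigmaM := (dq_sigmaM DQ).
Local Notation sigma1 := (dq_sigma1 DQ).
Local Notation central := (dq_central DQ).
Local Notation up := (up_path e b).
Local Notation down := (down_path e a).

Lemma sigma0 : sigma 0 = 0.
Proof. by apply: (addIr (sigma 0)); rewrite -sigmaD !add0r. Qed.

Lemma sigmaN x : sigma (- x) = - sigma x.
Proof. by apply: (addIr (sigma x)); rewrite -sigmaD !addNr sigma0. Qed.

Lemma sigmaB x y : sigma (x - y) = sigma x - sigma y.
Proof. by rewrite sigmaD sigmaN. Qed.

Lemma e_up k d : (k + d < n)%N -> e (k + d)%N * up k d = up k d.
Proof.
case: d => [|d] kd /=; first by rewrite addn0 (dq_idem DQ) // -[k]addn0.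
by rewrite mulrA addnS (dq_eb DQ) // -addnS.
Qed.

Lemma up_e k d : (k + d < n)%N -> up k d * e k = up k d.
Proof.
elim: d => [|d IHd] kd /=; first by rewrite (dq_idem DQ) // -[k]addn0.
by rewrite -mulrA IHd //; apply: leq_trans kd; rewrite addnS.
Qed.

Lemma e_down k d : (k + d < n)%N -> e k * down k d = down k d.
Proof.
elim: d => [|d IHd] kd /=; first by rewrite (dq_idem DQ) // -[k]addn0.
by rewrite mulrA IHd //; apply: leq_trans kd; rewrite addnS.
Qed.

Lemma upSr k d : (k.+1 + d < n)%N -> up k d.+1 = up k.+1 d * b k.
Proof.
elim: d => [|d IHd] kd.
  by rewrite /= addn0 (dq_be DQ) ?(dq_eb DQ) // -[k.+1]addn0.
have -> : up k d.+2 = b (k + d.+1)%N * up k d.+1 by [].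
rewrite IHd; last by apply: leq_trans kd; rewrite addnS.
by rewrite mulrA -addSnnS.
Qed.

(** The scalar of the round trip from [k] up to [k + d] and back, which is also the quotient of
    [G (k + d)] by [G k]. *)
Definition weight k d : S := \prod_(l < d) F (k + l).+1.

Lemma down_up k d : (k + d < n)%N -> down k d * up k d = sigma (weight k d) * e k.
Proof.
elim: d => [|d IHd] kd.
  by rewrite /weight big_ord0 sigma1 mul1r /= (dq_idem DQ) // -[k]addn0.
have kd' : (k + d < n)%N by apply: leq_trans kd; rewrite addnS.
have kd1 : ((k + d).+1 < n)%N by rewrite -addnS.
rewrite /= -mulrA (mulrA (a _)) (dq_ab DQ kd1) -(mulrA (sigma _)).
rewrite e_up // mulrA -central -mulrA IHd //.
by rewrite /weight big_ord_recr /= mulrA -sigmaM mulrC.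
Qed.

Lemma prime_weight k d x : (k + d < n)%N -> divides (F k) (x * weight k d) ->
  divides (F k) x.
Proof.
move=> kd; have k_lt : (k < n)%N by apply: leq_ltn_trans kd; rewrite leq_addr.
have [_ _ Fp] := cs_prime CS k_lt; case/Fp=> //.
rewrite /weight; elim: d kd => [|d IHd] kd.
  by rewrite big_ord0; have [_ ? _] := cs_prime CS k_lt.
rewrite big_ord_recr /= => /Fp[/IHd|]; first by apply; apply: leq_trans kd; rewrite addnS.
move=> Fkl; case: (cs_coprime CS k_lt _ _ Fkl); first by rewrite -addnS.
by move=> /eqP; rewrite -addnS -[X in X == _]addn0 eqn_add2l.
Qed.

(** The prime [F l] divides none of the factors of [G k], so in x F_l = c G_k it divides [c] and can
    be cancelled in the domain. *)
Lemma G_cancel k l x : (k < l)%N -> (l < n)%N -> divides (G k) (x * F l) ->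
  divides (G k) x.
Proof.
move=> kl ln [c xc]; have [Fl0 _ Fp] := cs_prime CS ln.
have Fl_G i : (i <= l)%N -> ~ divides (F l) (\prod_(j < i) F j).
  elim: i => [|i IHi] il.
    by rewrite big_ord0; have [_ ? _] := cs_prime CS ln.
  rewrite big_ord_recr /= => /Fp[/IHi|]; first by apply; exact: ltnW.
  apply: cs_coprime => //; first exact: ltn_trans ln.
  by move=> li; rewrite li ltnn in il.
have [|[c' c'E]|] := Fp c (G k); first by exists x; rewrite -xc.
  have /(cs_domain CS)[Fl0'|/eqP] : F l * (x - c' * G k) = 0.
  - by rewrite mulrBr mulrC xc c'E mulrA (mulrC (F l)) subrr.
  - by case: Fl0.
  by rewrite subr_eq0 => /eqP ->; exists c'.
by move/(Fl_G k.+1 kl).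
Qed.

Lemma ideal_by_rows (U : submodule (A^o : lmodType A)) (r : A) :
  (forall j, (j < n)%N -> U (e j * r)) -> U r.
Proof.
move=> Ur; have -> : r = \sum_(j < n) e j * r by rewrite -mulr_suml (dq_sum DQ) mul1r.
by elim/big_ind: _ => [|x y Ux Uy|j _]; [exact: sub0 | exact: subD | exact: Ur].
Qed.

Lemma divF_G k : divides (F k) (G k).
Proof. by rewrite /G big_ord_recr /=; exists (\prod_(l < k) F l). Qed.

Lemma divides_trans (x y z : S) : divides x y -> divides y z -> divides x z.
Proof. by move=> [c ->] [c' ->]; exists (c' * c); rewrite mulrA. Qed.

(* A/W k is the module Delta_k. *)
Definition W k : submodule (A^o : lmodType A) :=
  if k is k'.+1 then adjoin (annihilator (e k)) (a k') else annihilator (e k).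

Lemma Z_le_W k (r : A) : r * e k = 0 -> W k r.
Proof. by case: k => // k rk; exact: adjoin_le. Qed.

Lemma W_sub_e k (r : A) : (k < n)%N -> W k (r - r * e k).
Proof. by move=> kn; apply: Z_le_W; rewrite mulrBl -mulrA (dq_idem DQ kn) subrr. Qed.

Lemma W_mul_e k (r : A) : (k < n)%N -> W k r <-> W k (r * e k).
Proof.
move=> kn; split=> [Wr|]; last exact/idealBr/W_sub_e.
rewrite -(subKr r (r * e k)); apply: subB => //; exact: W_sub_e.
Qed.

Lemma W_below j k (r : A) : (j < k)%N -> (k < n)%N -> W k (e j * r * e k).
Proof.
case: k => // k; rewrite ltnS => /subnKC; move: (k - j)%N => d <-.
rewrite -addnS => kn; have [x ->] := dq_down DQ r kn.
have -> : down j d.+1 = down j d * a (j + d)%N by [].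
by rewrite addnS mulrA; exact: adjoin_mem.
Qed.

Lemma W_F k : (k < n)%N -> W k (sigma (F k) * e k).
Proof.
case: k => [|k] kn; last by rewrite -(dq_ba DQ kn); exact: adjoin_mem.
have -> : sigma (F 0%N) * e 0%N = 0.
  by apply/(dq_zero DQ) => //; exists 1; rewrite /G big_ord_recl big_ord0 mulr1 mul1r.
exact: sub0.
Qed.

Lemma W_F_up k d x : (k + d < n)%N -> divides (F k) x -> W k (sigma x * up k d).
Proof.
move=> kd [c ->]; have kn : (k < n)%N by apply: leq_ltn_trans kd; rewrite leq_addr.
rewrite -(up_e kd) sigmaM -mulrA (mulrA (sigma (F k))) (central (F k)) -mulrA.
by do 2!apply: idealM; exact: W_F.
Qed.

(** For j < k a path from [k] to [j] begins with the arrow [a] leaving [k], so it vanishes in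
    Delta_k; for j >= k the row is generated by one upward path. *)
Lemma W_row k j (r : A) : (k < n)%N -> (j < n)%N ->
  W k (e j * r * e k) \/ exists d x, j = (k + d)%N /\ e j * r * e k = sigma x * up k d.
Proof.
move=> kn jn; have [jk|/subnKC jE] := ltnP j k; first by left; exact: W_below.
right; have [|x xE] := @dq_up _ _ _ _ _ DQ k (j - k) r; first by rewrite jE.
by exists (j - k)%N, x; rewrite -xE jE.
Qed.

(** At the vertex [k] the left ideal generated by the arrow [a] leaving [k] contributes only
    multiples of b a, which is [F k]; the relation [G k = 0] is a multiple of [F k] as well. *)
Lemma W_vertex k x : (k < n)%N -> W k (sigma x * e k) -> divides (F k) x.
Proof.
move=> kn Wx; suff [c Gxc] : exists c, divides (G k) (x - c * F k).
  have [c' xE] := divides_trans (divF_G k) Gxc.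
  by exists (c' + c); rewrite mulrDl -xE subrK.
case: k kn Wx => [|k] kn /=.
  rewrite -mulrA (dq_idem DQ kn) => /(dq_zero DQ x kn) Gx.
  by exists 0; rewrite mul0r subr0.
move=> [r]; rewrite mulrBl -!mulrA (dq_idem DQ kn) (dq_ae DQ kn).
move=> /eqP; rewrite subr_eq0 => /eqP xr.
have [c cE] : exists c, e k.+1 * r * e k = sigma c * up k 1.
  by have [|c] := @dq_up _ _ _ _ _ DQ k 1 r; rewrite addn1 // => cE; exists c.
exists c; apply/(dq_zero DQ _ kn); rewrite sigmaB mulrBl.
have -> : sigma x * e k.+1 = e k.+1 * (sigma x * e k.+1).
  by rewrite mulrA -central -mulrA (dq_idem DQ kn).
rewrite xr -(dq_ea DQ kn) !mulrA cE /= addn0 (dq_be DQ kn) -mulrA (dq_ba DQ kn).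
by rewrite mulrA -sigmaM subrr.
Qed.

(** Multiplying by the downward path brings the row to the vertex [k], at the cost of a weight prime
    to [F k]. Together with [W_F_up] this makes each row from [k] on a copy of S/(F k). *)
Lemma W_up_inv k d x : (k + d < n)%N -> W k (sigma x * up k d) -> divides (F k) x.
Proof.
move=> kd Wx; have kn : (k < n)%N by apply: leq_ltn_trans kd; rewrite leq_addr.
apply: (prime_weight kd); apply: (W_vertex kn).
rewrite sigmaM -mulrA -down_up // mulrA central -mulrA; exact: idealM.
Qed.

Lemma G_weight j d x y : (j + d < n)%N -> divides (G j) (y * x * weight j d) ->
  (exists l, [/\ (j < l)%N, (l < n)%N & y = F l]) -> divides (G j) x.
Proof.
move=> jd H [l [jl ln yE]]; apply: (G_cancel jl ln); rewrite -yE mulrC.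
elim: d jd H => [|d IHd] jd; first by rewrite /weight big_ord0 mulr1.
rewrite /weight big_ord_recr /= mulrA => /G_cancel H.
apply: IHd; first by apply: leq_trans jd; rewrite addnS.
by apply: H; [rewrite ltnS leq_addr | rewrite -addnS].
Qed.

(** The entry (j, k) is a copy of S/(G i) with i the minimum of [j] and [k]; as [l] exceeds this
    minimum, [F l] is regular on it. A return path reduces the claim to divisibility by [G i]. *)
Lemma entry_torsion_free j k l (r : A) : (j < n)%N -> (k < l)%N -> (l < n)%N ->
  sigma (F l) * (e j * r * e k) = 0 -> e j * r * e k = 0.
Proof.
move=> jn kl ln.
have kn := ltn_trans kl ln.
have [/subnKC jE|/ltnW/subnKC kE] := leqP k j.
  have kd : (k + (j - k) < n)%N by rewrite jE.
  have [x] := dq_up DQ r kd; rewrite jE => -> H.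
  rewrite -up_e // mulrA central -mulrA (dq_zero DQ x kn).2 ?mulr0 //.
  apply: (@G_weight _ _ x (F l) kd); last by exists l.
  apply/(dq_zero DQ _ kn); rewrite sigmaM -mulrA -down_up // mulrA central -mulrA.
  by rewrite sigmaM -mulrA H mulr0.
have jd : (j + (k - j) < n)%N by rewrite kE.
have [x] := dq_down DQ r jd; rewrite kE => -> H.
rewrite -e_down // mulrA (dq_zero DQ x jn).2 ?mul0r //.
apply: (@G_weight _ _ x (F l) jd).
  apply/(dq_zero DQ _ jn); rewrite sigmaM -mulrA -down_up // sigmaM !mulrA.
  by rewrite -[_ * sigma x * _]mulrA H mul0r.
by exists l; split=> //; apply: leq_ltn_trans kl; rewrite -kE leq_addr.
Qed.

(** Right multiplication by [b k] turns [a k] into the scalar [F k.+1], which is regular on the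
    column [k]. *)
Lemma mulr_a_inj k (r : A) : (k.+1 < n)%N -> r * a k = 0 -> r * e k = 0.
Proof.
move=> kn ra; have kn' := ltnW kn.
have -> : r * e k = \sum_(j < n) e j * r * e k.
  by rewrite -mulr_suml -mulr_suml (dq_sum DQ) mul1r.
apply: big1 => j _; apply: (entry_torsion_free (l := k.+1)) => //.
rewrite central -mulrA -central -(dq_ab DQ kn) !mulrA -(mulrA (e j)) ra.
by rewrite mulr0 mul0r.
Qed.

(* A/V k is the module E_k. *)
Definition V k := adjoin (W k) (sigma (t k)).

Lemma W_le_V k (r : A) : W k r -> V k r. Proof. exact: adjoin_le. Qed.

Lemma max_F_t k : (k < n)%N -> m (F k) /\ m (t k).
Proof.
move=> kn; split; apply/(cs_max CS kn).
  by exists 1, 0; rewrite mul1r mul0r addr0.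
by exists 0, 1; rewrite mul1r mul0r add0r.
Qed.

Lemma V_max k x (r : A) : (k < n)%N -> m x -> V k (r * (sigma x * e k)).
Proof.
move=> kn /(cs_max CS kn)[c [c' ->]]; apply: idealM; rewrite sigmaD mulrDl.
apply: subD; rewrite sigmaM -mulrA.
  by apply: idealM; apply: W_le_V; exact: W_F.
by apply: idealM; rewrite central; exact: adjoin_mem.
Qed.

(** Modulo W_k the condition says that x - y t_k is a multiple of F_k, and m contains both
    parameters. With [V_max], the rows of E_k from [k] on are copies of the residue field. *)
Lemma V_up k d x : (k + d < n)%N -> V k (sigma x * up k d) -> m x.
Proof.
move=> kd [r]; have kn : (k < n)%N by apply: leq_ltn_trans kd; rewrite leq_addr.
have [m0 mD mM] := cs_ideal CS; have [mF mt] := max_F_t kn.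
move/(W_mul_e _ kn)/(idealM (e (k + d)%N)).
have [y yE] := dq_up DQ r kd.
have -> : e (k + d)%N * ((sigma x * up k d - r * sigma (t k)) * e k) =
    sigma (x - y * t k) * up k d.
  rewrite mulrBl mulrBr sigmaB mulrBl; congr (_ - _).
    by rewrite -mulrA up_e // mulrA -central -mulrA e_up.
  rewrite -(central (t k) r) -mulrA (mulrA (e _)) -(central (t k)) -mulrA.
  by rewrite (mulrA (e _)) yE mulrA -sigmaM mulrC.
move=> /(W_up_inv kd)[c] /eqP; rewrite subr_eq => /eqP ->.
by apply: mD; exact: mM.
Qed.

(** This embeds E_(k+1) into E_k by [b k]. The parameters of the curve k+1 act as zero on E_k
    because they lie in the common maximal ideal; conversely, both modules have the residue field in
    each row above [k]. *)
Lemma V_mul_b k (r : A) : (k.+1 < n)%N -> V k.+1 r <-> V k (r * b k).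
Proof.
move=> kn; have kn' := ltnW kn.
have [mF mt] := max_F_t kn; have [m0 mD mM] := cs_ideal CS.
have V_sub (r' : A) : V k.+1 r' -> V k (r' * b k).
  move=> [c [c' Hr]].
  have {}Hr : (r' - c * sigma (t k.+1) - c' * a k) * e k.+1 = 0 by [].
  have /eqP : (r' - c * sigma (t k.+1) - c' * a k) * b k = 0.
    by rewrite -[b k](dq_eb DQ kn) mulrA Hr mul0r.
  rewrite mulrBl mulrBl -addrA -opprD subr_eq0 => /eqP ->.
  apply: subD.
    rewrite -mulrA -(dq_be DQ kn) (mulrA (sigma _)) central -(mulrA (b k)) (mulrA c).
    exact: V_max.
  by rewrite -mulrA (dq_ab DQ kn); exact: V_max.
split=> [|Vrb]; first exact: V_sub.
apply: (@idealBr _ _ _ (r * e k.+1)); first exact/W_le_V/W_sub_e.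
apply: ideal_by_rows => j jn; rewrite mulrA.
have [Wj|[d [x [jE xE]]]] := W_row r kn jn; first exact: W_le_V.
rewrite xE; have kd : (k.+1 + d < n)%N by rewrite -jE.
rewrite -up_e // mulrA central -mulrA; apply: V_max => //.
have kd' : (k + d.+1 < n)%N by rewrite -addSnnS.
apply: (V_up kd'); rewrite upSr // mulrA -xE -!mulrA (dq_eb DQ kn).
exact: idealM.
Qed.

(** * Upper bound 3 for all modules *)

Lemma pdle_Z k : (k < n)%N -> pdle 0 (quotmod (annihilator (e k))).
Proof. by move=> kn; apply: idempotent_projective; exact: (dq_idem DQ). Qed.

Lemma pdle_W k : (k < n)%N -> pdle 1 (quotmod (W k)).
Proof.
case: k => [|k] kn; first exact/pdle_S/pdle_Z.
apply: ideal_pdle_cokernel; last exact/pdle_S/pdle_Z.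
have -> : colon (annihilator (e k.+1)) (a k) = annihilator (e k).
  apply: submodule_eq => r /=; rewrite -mulrA (dq_ae DQ kn).
  split; first exact: mulr_a_inj.
  by rewrite -(dq_ea DQ kn) mulrA => ->; rewrite mul0r.
exact/pdle_Z/ltnW.
Qed.

(** Each nonzero row of Delta_k is S/(F k), on which [t k] is regular because the prime [F k] does
    not divide it. *)
Lemma W_mul_t k (r : A) : (k < n)%N -> W k (r * sigma (t k)) -> W k r.
Proof.
move=> kn Wrt; apply/(W_mul_e _ kn); apply: ideal_by_rows => j jn; rewrite mulrA.
have [//|[d [x [jE xE]]]] := W_row r kn jn.
have kd : (k + d < n)%N by rewrite -jE.
rewrite xE; apply: W_F_up => //.
have [_ _ Fp] := cs_prime CS kn.
suff : divides (F k) (x * t k) by case/Fp => // /(cs_unif CS kn).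
apply: (W_up_inv kd); rewrite sigmaM -mulrA (central (t k)) mulrA -xE.
rewrite -mulrA -(central (t k) (e k)) -(mulrA (e j)) (mulrA r).
apply: idealM; exact: ((W_mul_e _ kn).1 Wrt).
Qed.

Lemma pdle_V k : (k < n)%N -> pdle 2 (quotmod (V k)).
Proof.
move=> kn; apply: ideal_pdle_cokernel; last exact/pdle_S/pdle_W.
have -> : colon (W k) (sigma (t k)) = W k; last exact: pdle_W.
apply: submodule_eq => r /=; split; first exact: W_mul_t.
by rewrite -central; exact: idealM.
Qed.

(** The last vertex is left out: no arrow [b] leaves it, and there E_k itself is simple, of
    dimension at most 2. *)
Lemma pdle_simple k : (k.+1 < n)%N -> pdle 3 (quotmod (adjoin (V k) (b k))).
Proof.
move=> kn; apply: ideal_pdle_cokernel; last exact/pdle_S/pdle_V/ltnW.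
have -> : colon (V k) (b k) = V k.+1; last exact: pdle_V.
by apply: submodule_eq => r; rewrite (V_mul_b _ kn).
Qed.

(** E_k has a largest proper submodule: a unit coefficient at the vertex [k] would put [e k], hence
    1, into U. The ideal [L] stands for V_k + A b_k in general and for V_k at the last vertex. *)
Lemma over_V (U L : submodule (A^o : lmodType A)) k : (k < n)%N ->
  (forall r, V k r -> U r) -> ~ U 1 -> (forall r, V k r -> L r) ->
  ((k.+1 < n)%N -> L (b k)) -> forall r, U r -> L r.
Proof.
move=> kn VU U1 VL Lb r Ur.
have sub_e (r' : A) : V k (r' - r' * e k) by apply/W_le_V/W_sub_e.
apply: (idealBr (VL _ (sub_e r))); apply: ideal_by_rows => j jn; rewrite mulrA.
have [/W_le_V/VL//|[d [x [jE xE]]]] := W_row r kn jn.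
rewrite xE; have kd : (k + d < n)%N by rewrite -jE.
case: d jE xE kd => [|d] jE xE kd.
  have [mx|[u ux]] := cs_local CS x.
    by rewrite -[sigma x * _]mul1r; apply/VL/V_max.
  case: U1; apply: (idealBr (VU _ (sub_e 1))); rewrite mul1r.
  rewrite -[e k]mul1r -sigma1 -ux sigmaM -mulrA -/(up k 0) -xE.
  apply: idealM; rewrite -mulrA; apply: idealM.
  by rewrite -(subKr r (r * e k)); apply: subB => //; exact: VU.
rewrite upSr ?addSnnS // mulrA; apply/idealM/Lb.
by apply: leq_ltn_trans kd; rewrite addnS ltnS leq_addr.
Qed.

Lemma pdle_over_V k (U : submodule (A^o : lmodType A)) : (k < n)%N ->
  (forall r, V k r -> U r) -> pdle 3 (quotmod U).
Proof.
(* Descending induction on the vertex, [d] counting the vertices above [k]: the top factor of A/U is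
   simple, and the rest is a quotient of E_(k+1). *)
move=> kn; have [d dE] : exists d, n = (k + d).+1.
  by exists (n - k.+1)%N; rewrite -addSn subnKC.
elim: d k kn dE U => [|d IHd] k kn dE U VU.
  have [U1|U1] := pselect (U 1); first exact: unit_ideal_pdle.
  have -> : U = V k; last exact/pdle_S/pdle_V.
  apply: submodule_eq => r; split; last exact: VU.
  apply: (over_V kn VU U1) => //; by rewrite dE addn0 ltnn.
have [U1|U1] := pselect (U 1); first exact: unit_ideal_pdle.
have kn' : (k.+1 < n)%N by rewrite dE ltnS addnS ltnS leq_addr.
apply: (ideal_pdle_extension (c := b k)).
  apply: (IHd k.+1) => //; first by rewrite dE addnS.
  by move=> r Vr; apply: VU; apply/(V_mul_b _ kn').
have -> : adjoin U (b k) = adjoin (V k) (b k); last exact: pdle_simple.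
apply: submodule_eq => r; split=> [] [c]; last by exists c; exact: VU.
move=> Urc; apply: (@idealBr _ _ _ (c * b k)); last exact: adjoin_mem.
apply: (over_V kn VU U1 _ _ Urc) => [r'|_]; first exact: adjoin_le.
by have := adjoin_mem (V k) (b k) 1; rewrite mul1r.
Qed.

(** Filtering by powers of [t k] leaves factors that are quotients of E_k = Delta_k / t_k
    Delta_k. *)
Lemma pdle_torsion k N (U : submodule (A^o : lmodType A)) : (k < n)%N ->
  (forall r, W k r -> U r) -> U (sigma (t k ^+ N)) -> pdle 3 (quotmod U).
Proof.
move=> kn; elim: N U => [|N IHN] U WU Ut.
  by apply: unit_ideal_pdle; rewrite -sigma1.
apply: (ideal_pdle_extension (c := sigma (t k))).
  apply: IHN => /= [r Wr|]; last by rewrite -sigmaM -exprSr.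
  by rewrite -central; apply/idealM/WU.
by apply: (pdle_over_V kn) => r [c Wrc]; exists c; exact: WU.
Qed.

Lemma pdle_over_W k (U : submodule (A^o : lmodType A)) : (k < n)%N ->
  (forall r, W k r -> U r) -> pdle 3 (quotmod U).
Proof.
move=> kn WU; have [UW|] := pselect (forall r, U r -> W k r).
  have -> : U = W k; last exact: (pdle_le (d := 1)) (pdle_W kn).
  by apply: submodule_eq => r; split=> [/UW|/WU].
move=> /existsNP[r] /not_implyP[Ur nWr].
have [j [jn nWj]] : exists j, (j < n)%N /\ ~ W k (e j * r * e k).
  apply: contrapT => H; apply: nWr; apply/(W_mul_e _ kn).
  apply: ideal_by_rows => j jn; rewrite mulrA; apply: contrapT => nW; apply: H.
  by exists j.
have [//|[d [x [jE xE]]]] := W_row r kn jn.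
have kd : (k + d < n)%N by rewrite -jE.
(* Some row of [r] survives in Delta_k. Returned to the vertex [k], it is x times a weight prime to
   [F k], hence nonzero in S/(F k), and a multiple of it is a power of [t k]. *)
have nFx : ~ divides (F k) (x * weight k d).
  by move=> /(prime_weight kd) Fx; apply: nWj; rewrite xE; exact: W_F_up.
have [u [N [c uE]]] := cs_dvr CS kn nFx.
apply: (pdle_torsion (N := N) kn WU).
apply: (@idealBr _ _ _ (sigma (t k ^+ N) * e k)); first exact/WU/W_sub_e.
have -> : t k ^+ N = u * (x * weight k d) - c * F k by rewrite uE addrK.
rewrite sigmaB mulrBl; apply: subB; last first.
  by rewrite sigmaM -mulrA; apply/idealM/WU/W_F.
rewrite !sigmaM -!mulrA -down_up // (mulrA (sigma x)) (central x) -mulrA -xE.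
do 2!apply: idealM; rewrite -mulrA; apply: idealM.
by rewrite -(subKr r (r * e k)); apply: subB => //; exact/WU/W_sub_e.
Qed.

(** The filtration comes from the chain of injections A e_0 -> ... -> A e_k given by the [a], whose
    successive factors are Delta_0, ..., Delta_k. *)
Lemma pdle_over_Z k (U : submodule (A^o : lmodType A)) : (k < n)%N ->
  (forall r : A, r * e k = 0 -> U r) -> pdle 3 (quotmod U).
Proof.
elim: k U => [|k IHk] U kn ZU; first exact: (pdle_over_W kn).
apply: (ideal_pdle_extension (c := a k)).
  apply: IHk; first exact: ltnW.
  by move=> r rk; rewrite /= -(dq_ea DQ kn) mulrA rk mul0r; exact: sub0.
by apply: (pdle_over_W kn) => r [c Zrc]; exists c; exact: ZU.
Qed.

Theorem double_quiver_pdle (M : lmodType A) : pdle 3 M.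
Proof.
(* Cutting each element by the idempotents gives generators killed by some annihilator of [e k], so
   that the cyclic factors are quotients of A e_k. *)
pose x (ky : 'I_n * M) : M := e ky.1 *: ky.2.
apply: (pdle_generated (x := x)) => [y|[k y] U U_ann].
  have -> : y = \sum_(k < n) act (x (k, y)) 1.
    rewrite -[LHS]scale1r -[X in X *: _](dq_sum DQ) scaler_suml; apply: eq_bigr => k _.
    by rewrite -[RHS]/((1 : A) *: (e k *: y)) scale1r.
  have [s0 sD _] := span_sub (fun i => act (x i)) (fun=> True).
  by elim/big_ind: _ => // k _; exact: (span_single (fun i => act (x i))).
apply: (pdle_over_Z (ltn_ord k)) => r rk; apply: U_ann.
by rewrite /x scalerA rk scale0r.
Qed.

(** * Lower bound: a module of dimension greater than 2 *)

Lemma pdle_colon d (U : submodule (A^o : lmodType A)) (c : A) :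
  pdle 0 (quotmod U) -> pdle d.+1 (quotmod (adjoin U c)) ->
  pdle d (quotmod (colon U c)).
Proof.
move=> U_proj [K [P [i' [p' [P_proj K_pd ip']]]]].
have [i [p ip]] := colon_adjoin_exact U c.
exact: pdle_syzygy ip ip' U_proj P_proj K_pd.
Qed.

Lemma prime_F k x y : (k < n)%N -> divides (F k) (x * y) ->
  divides (F k) x \/ divides (F k) y.
Proof. by move=> /(cs_prime CS)[_ _]; apply. Qed.

Lemma F0_e0 : (0 < n)%N -> sigma (F 0%N) * e 0%N = 0.
Proof.
move=> n0; apply/(dq_zero DQ) => //.
by exists 1; rewrite /G big_ord_recl big_ord0 mulr1 mul1r.
Qed.

Lemma div_F0 x : (1 < n)%N -> sigma x * a 0%N = 0 -> divides (F 0%N) x.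
Proof.
move=> n1 xa; have n0 := ltnW n1.
(* [W 0] is the annihilator of [e 0], so membership in it is an equation. *)
have : W 0 (sigma (x * F 1%N) * e 0%N).
  by rewrite sigmaM -mulrA -(dq_ab DQ n1) mulrA xa mul0r; exact: sub0.
by move/(W_vertex n0)/(prime_F n0) => [//|/(cs_coprime CS n0 n1)[]].
Qed.

(** The first syzygy A b_0 is thereby A e_1 / A F_0 e_1. If r b_0 = 0, row 0 of r e_1 is x a_0 with
    F_0 dividing x, hence zero, and the other rows are multiples of F_0. *)
Lemma ker_b0 : (1 < n)%N ->
  colon (annihilator (e 0%N)) (b 0%N) = adjoin (annihilator (e 1%N)) (sigma (F 0%N)).
Proof.
move=> n1; have n0 := ltnW n1; apply: submodule_eq => r; split; last first.
  move=> [c /= rc]; rewrite -mulrA (dq_be DQ n1) -(dq_eb DQ n1) mulrA.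
  move/eqP: rc; rewrite mulrBl subr_eq0 => /eqP ->.
  rewrite -!mulrA (dq_eb DQ n1) -(dq_be DQ n1) (mulrA (sigma _)) central.
  by rewrite -mulrA F0_e0 // !mulr0.
move=> rb; have {}rb : r * b 0%N = 0 by move: rb; rewrite /= -mulrA (dq_be DQ n1).
apply: (@idealBr _ _ _ (r * e 1%N)).
  by apply: adjoin_le; rewrite /= mulrBl -mulrA (dq_idem DQ n1) subrr.
apply: ideal_by_rows => j jn; rewrite mulrA.
have ejrb : e j * r * e 1%N * b 0%N = 0 by rewrite -!mulrA (dq_eb DQ n1) rb mulr0.
case: j jn ejrb => [|j] jn.
  have [x ->] : exists x, e 0%N * r * e 1%N = sigma x * a 0%N.
    have [x xE] := @dq_down _ _ _ _ _ DQ 0 1 r n1.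
    by exists x; rewrite xE /= (dq_ea DQ n1).
  move=> xab; have [c ->] : divides (F 0%N) x.
    have : W 0 (sigma (x * F 1%N) * e 0%N).
      by rewrite sigmaM -mulrA -(dq_ab DQ n1) mulrA xab; exact: sub0.
    by move/(W_vertex n0)/(prime_F n0) => [//|/(cs_coprime CS n0 n1)[]].
  have -> : sigma (c * F 0%N) * a 0%N = 0; last exact: sub0.
  by rewrite -(dq_ea DQ n1) mulrA sigmaM -(mulrA (sigma c)) F0_e0 // mulr0 mul0r.
have [x] := @dq_up _ _ _ _ _ DQ 1 j r jn; rewrite add1n => -> xb.
have [c ->] : divides (F 0%N) x.
  apply: (@W_up_inv 0 j.+1 x jn); rewrite upSr // mulrA xb; exact: sub0.
by rewrite sigmaM -mulrA (central (F 0%N)) mulrA; exact: adjoin_mem.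
Qed.

Lemma not_pdle2 : (1 < n)%N -> exists M : lmodType A, ~ pdle 2 M.
Proof.
move=> n1; have n0 := ltnW n1.
exists (quotmod (adjoin (annihilator (e 0%N)) (b 0%N))).
move=> /(pdle_colon (pdle_Z n0)); rewrite ker_b0 // => /(pdle_colon (pdle_Z n1)).
(* [H] consists of the r with r F_0 e_1 = 0 and presents Delta_1. A section [s] would give an [x]
   killed by [H] on the left and congruent to 1 modulo [H]. *)
set H := colon _ _ => H_proj.
have [s sK] := H_proj _ _ (quotmod_pi H) (idfun : {linear quotmod H -> quotmod H})
  (quotmod_pi_surj (U := H)).
pose x : A := s (quotmod_pi H 1).
have Hx (h : A) : H h -> h * x = 0.
  move=> Hh; rewrite -[LHS]/(h *: (s (quotmod_pi H 1))) -linearZ -linearZ /=.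
  by rewrite -[h *: (1 : A^o)]/(h * 1) mulr1 (quotmod_pi_eq0 H h).2 ?linear0.
have /quotmod_eq /= Hx1 : quotmod_pi H (x : A^o) = quotmod_pi H 1 by exact: sK.
have ax : a 0%N * x = 0.
  apply: Hx; rewrite /= -central -mulrA (dq_ae DQ n1) -(dq_ea DQ n1) mulrA.
  by rewrite F0_e0 // mul0r.
have ex : e 1%N * x = x.
  apply/eqP; rewrite eq_sym -subr_eq0 -{1}[x]mul1r -mulrBl; apply/eqP/Hx.
  rewrite /= -mulrA central mulrA mulrBl (dq_idem DQ n1) mul1r subrr mul0r //.
have [z zE] := @dq_up _ _ _ _ _ DQ 1 0 x n1.
have {}zE : x * e 1%N = sigma z * e 1%N by rewrite -[X in X * _]ex zE.
have [c zF] : divides (F 0%N) z.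
  by apply: div_F0; rewrite // central -(dq_ae DQ n1) -mulrA -central -zE mulrA ax mul0r.
have Gz : divides (G 1) (z * F 0%N - F 0%N).
  apply/(dq_zero DQ _ n1).
  rewrite -Hx1 -[RHS]mulrA (central (F 0%N)) mulrA (mulrBl (e _)) zE mul1r mulrBl.
  by rewrite -mulrA -!central mulrA -sigmaM -mulrBl -sigmaB.
have {}Gz : divides (F 1%N) ((z - 1) * F 0%N).
  by rewrite mulrBl mul1r; apply: divides_trans Gz; exact: divF_G.
(* Being killed by [a 0] makes z divisible by F_0, while congruence to 1 makes z - 1 divisible by
   F_1; both would lie in m. *)
have [[c' zc']|/(cs_coprime CS n1 n0)[]//] := prime_F n1 Gz.
have [m0 mD mM] := cs_ideal CS; have [mF0 _] := max_F_t n0; have [mF1 _] := max_F_t n1.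
apply: (cs_proper CS); rewrite -(subKr z 1) zc' zF -mulNr.
by apply: mD; exact: mM.
Qed.

Theorem double_quiver_lgldim : (1 < n)%N -> lgldim A 3.
Proof.
move=> n1; split=> [M|d A_d]; first exact/pdle_proj_dim/double_quiver_pdle.
rewrite leqNgt ltnS; apply/negP => d2; have [M] := not_pdle2 n1; apply.
exact/(pdle_le d2)/proj_dim_pdle/A_d.
Qed.

End DoubleQuiver.

Lemma double_quiver_opp (S : comNzRingType) (n : nat) (F : nat -> S)
    (A : pzRingType) (sigma : S -> A) (e a b : nat -> A) :
  double_quiver n F sigma e a b ->
  @double_quiver S n F A^c sigma e b a.
Proof.
have up_opp k d : @up_path A^c e a k d = down_path e a k d by elim: d => //= d ->.
have down_opp k d : @down_path A^c e b k d = up_path e b k d by elim: d => //= d ->.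
case=> sD sM s1 sC ee e1 ea ae eb be ab ba e0 up dn; split.
- exact: sD.
- by move=> x y; rewrite sM; exact: sC.
- exact: s1.
- by move=> x r; exact/esym/sC.
- exact: ee.
- exact: e1.
- exact: be.
- exact: eb.
- exact: ae.
- exact: ea.
- by move=> k kn; rewrite -[RHS]sC; exact: ab.
- by move=> k kn; rewrite -[RHS]sC; exact: ba.
- by move=> k x kn; rewrite -(e0 k x kn) sC.
- move=> k d r kd; have [x xE] := dn k d r kd; exists x.
  by rewrite up_opp -[RHS]sC -xE; exact: (@mulrA A (e k) r (e (k + d)%N)).
move=> k d r kd; have [x xE] := up k d r kd; exists x.
by rewrite down_opp -[RHS]sC -xE; exact: (@mulrA A (e (k + d)%N) r (e k)).
Qed.

(** * Regular local rings of dimension two *)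

Lemma pquot_pi_eq0 (S : comPzRingType) (g x : S) :
  pquot_pi g x = 0 <-> divides g x.
Proof.
have <- : pquot_pi g 0 = 0.
  by apply: (addIr (pquot_pi g 0)); rewrite -pquot_piD !add0r.
by rewrite pquot_eq subr0.
Qed.

(** * Power series in a complete ring *)

Section AdicIdeals.
Variables (S : comNzRingType) (m : set S).
Hypothesis m_ideal : is_ideal m.

Lemma ideal_sum (I : set S) (k : nat) (g : 'I_k -> S) : is_ideal I ->
  (forall i, I (g i)) -> I (\sum_(i < k) g i).
Proof. by move=> [I0 ID _] Ig; elim/big_ind: _ => // x y; exact: ID. Qed.

Lemma ideal_exp_ideal k : is_ideal (ideal_exp m k).
Proof.
case: k => [|k]; first by split.
split.
- exists 0%N, (fun=> 0), (fun=> 0); split; try by case.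
  by rewrite big_ord0.
- move=> _ _ [k1 [a1 [b1 [a1m b1m ->]]]] [k2 [a2 [b2 [a2m b2m ->]]]].
  pose glue (c1 : 'I_k1 -> S) (c2 : 'I_k2 -> S) (i : 'I_(k1 + k2)) :=
    match split i with inl j => c1 j | inr j => c2 j end.
  exists (k1 + k2)%N, (glue a1 a2), (glue b1 b2); split.
  + by move=> i; rewrite /glue; case: split.
  + by move=> i; rewrite /glue; case: split.
  rewrite big_split_ord; congr (_ + _); apply: eq_bigr => i _; rewrite /glue.
    by rewrite (unsplitK (inl i)).
  by rewrite (unsplitK (inr i)).
move=> c _ [k1 [a1 [b1 [a1m b1m ->]]]]; have [_ _ mM] := m_ideal.
exists k1, (fun i => c * a1 i), b1; split=> // [i|]; first exact: mM.
by rewrite mulr_sumr; apply: eq_bigr => i _; rewrite mulrA.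
Qed.

Lemma ideal_exp_mul k x y : m x -> ideal_exp m k y -> ideal_exp m k.+1 (x * y).
Proof.
by move=> mx my; exists 1%N, (fun=> x), (fun=> y); split=> //; rewrite big_ord1.
Qed.

Lemma ideal_exp_pow k x y : m x -> ideal_exp m k (x ^+ k * y).
Proof.
by move=> mx; elim: k => [|k IHk] //; rewrite exprS -mulrA; exact: ideal_exp_mul.
Qed.

Hypothesis m_complete : adic_complete m.

Lemma power_series_cvg (c : nat -> S) (z : S) : m z ->
  exists l, forall k, ideal_exp m k (\sum_(i < k) c i * z ^+ i - l).
Proof.
move=> mz; pose u k := \sum_(i < k) c i * z ^+ i.
have u_tail k i : (k <= i)%N -> ideal_exp m k (u i - u k).
  have [k0 kD kM] := ideal_exp_ideal k.
  move=> /subnKC <-; elim: (i - k)%N => [|d IHd]; first by rewrite addn0 subrr.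
  rewrite addnS /u big_ord_recr /= addrAC; apply: kD => //.
  by rewrite exprD mulrC -mulrA; exact: ideal_exp_pow.
have opp k x : ideal_exp m k x -> ideal_exp m k (- x).
  by have [_ _ kM] := ideal_exp_ideal k; rewrite -mulN1r; exact: kM.
have [_ /(_ u)[|l ul]] := m_complete.
  move=> k; exists k => i j ki kj; have [_ kD _] := ideal_exp_ideal k.
  rewrite -(subrKA (u k)); apply: kD; first exact: u_tail.
  by rewrite -opprB; apply/opp/u_tail.
exists l => k; have [N NP] := ul k; have [_ kD _] := ideal_exp_ideal k.
rewrite -/(u k) -(subrKA (u (maxn k N))); apply: kD.
  by rewrite -opprB; apply/opp/u_tail; exact: leq_maxl.
by apply: NP; exact: leq_maxr.
Qed.

(* Iterating x = c y + z x' expresses x as y times a convergent power series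
   in z. *)
Lemma divides_iter (J : S -> Prop) (y z : S) : m z ->
  (forall x, J x -> exists c x', x = c * y + z * x' /\ J x') ->
  forall x, J x -> divides y x.
Proof.
move=> mz Jstep x Jx.
(* One step of the iteration as a function on all of S, with the junk value (0, 0) outside [J],
   which the iterates never leave. *)
have [h hP] : {h : S -> S * S &
    forall x, J x -> x = (h x).1 * y + z * (h x).2 /\ J (h x).2}.
  apply: (choice (P := fun x p => J x -> x = p.1 * y + z * p.2 /\ J p.2)) => w.
  have [/Jstep[c [w' [wE Jw']]]|nJ] := pselect (J w); first by exists (c, w').
  by exists (0, 0).
pose X k := iter k (fun w => (h w).2) x.
have JX k : J (X k) by elim: k => [|k /hP[]].
have xE k : x = (\sum_(i < k) (h (X i)).1 * z ^+ i) * y + z ^+ k * X k.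
  elim: k => [|k IHk]; first by rewrite big_ord0 mul0r add0r expr0 mul1r.
  rewrite big_ord_recr /= mulrDl -addrA {1}IHk; congr (_ + _).
  rewrite {1}(hP _ (JX k)).1 mulrDr !mulrA -exprSr.
  by congr (_ * _ + _); rewrite mulrC.
have [l lP] := power_series_cvg (fun i => (h (X i)).1) mz.
have [sep _] := m_complete; exists l.
apply/eqP; rewrite -subr_eq0; apply/eqP/sep => k.
have [_ kD kM] := ideal_exp_ideal k.
rewrite {1}(xE k) addrAC -mulrBl; apply: kD; last exact: ideal_exp_pow.
by rewrite mulrC; apply: kM.
Qed.

End AdicIdeals.

(** * Regular parameters, discrete valuations and the domain property *)

Section RegularSurface.
Variables (S : comNzRingType) (m : set S).
Hypothesis S_regular : regular_local_ring m 2.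
Hypothesis S_complete : adic_complete m.

Lemma max_ideal : is_ideal m.
Proof. by case: S_regular => _ [[]]. Qed.

Lemma max_proper : ~ m 1.
Proof. by case: S_regular => _ [[]]. Qed.

Local Notation iter_div := (divides_iter max_ideal S_complete).

Lemma local_unit x : m x \/ exists u, u * x = 1.
Proof.
have [mx|mx] := pselect (m x); [by left | right].
have [m0 mD mM] := max_ideal.
have [_ [[_ _ m_max] _] _ _] := S_regular.
pose I : set S := fun y => exists a c, m a /\ y = a + c * x.
have I_ideal : is_ideal I.
  split; first by exists 0, 0; rewrite mul0r addr0.
    move=> _ _ [a [c [ma ->]]] [a' [c' [ma' ->]]]; exists (a + a'), (c + c').
    by split; [exact: mD | rewrite mulrDl addrACA].
  move=> d _ [a [c [ma ->]]]; exists (d * a), (d * c).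
  by split; [exact: mM | rewrite mulrDr mulrA].
have [a [c [ma ac]]] : I 1.
  apply: contrapT => nI1; apply: mx; rewrite -(m_max I I_ideal nI1).
    by exists 0, 1; rewrite add0r mul1r.
  by move=> y my; exists y, 0; rewrite mul0r addr0.
(* The geometric series: y = y (1 - a) + a y, iterated. *)
have [u uE] : divides (1 - a) 1.
  apply: (iter_div (J := fun=> True) (z := a)) => // y _.
  by exists y, y; split=> //; rewrite mulrBr mulr1 mulrC subrK.
by exists (u * c); rewrite -mulrA [RHS]uE {1}ac addrAC subrr add0r.
Qed.

Lemma proper_le_max (I : set S) : is_ideal I -> ~ I 1 -> forall x, I x -> m x.
Proof.
move=> [_ _ IM] I1 x Ix; have [//|[u ux]] := local_unit x.
by case: I1; rewrite -ux; exact: IM.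
Qed.

Section Curve.
Variable f : S.
Hypothesis f_prime : prime_element f.
Hypothesis f_notin_m2 : ~ ideal_exp m 2 f.

Lemma curve_in_max : m f.
Proof.
have [//|[u uf]] := local_unit f.
by have [_ nf1 _] := f_prime; case: nf1; exists u.
Qed.

Lemma exchange_generator g h a b :
  (forall x, m x <-> exists a b, x = a * g + b * h) ->
  f = a * g + b * h -> ~ m a ->
  forall x, m x <-> exists a b, x = a * f + b * h.
Proof.
move=> mE fE ma; have [//|[u ua]] := local_unit a.
have [m0 mD mM] := max_ideal.
move=> x; split=> [/mE[c [d ->]]|[c [d ->]]].
  exists (c * u), (d - c * u * b); rewrite fE mulrDr !mulrA.
  by rewrite -[c * u * a]mulrA ua mulr1 -addrA mulrBl [in RHS](addrC (_ * h)) subrK.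
apply: mD; apply: mM; first exact: curve_in_max.
by apply/mE; exists 0, 1; rewrite mul0r mul1r add0r.
Qed.

(** If both coefficients of [f] on two generators of [m] were in [m], then [f] would be in its
    square; so one is a unit and [f] replaces that generator. *)
Lemma curve_parameter : exists t, forall x, m x <-> exists a b, x = a * f + b * t.
Proof.
have [_ _ _ [g gE]] := S_regular.
have mE x : m x <-> exists a b, x = a * g ord0 + b * g ord_max.
  rewrite gE /generated_by /=; split=> [[a ->]|[a [b ->]]].
    exists (a ord0), (a ord_max); rewrite big_ord_recl big_ord1.
    by congr (_ + a _ * g _); apply: val_inj.
  exists (fun i => if i == ord0 then a else b).
  by rewrite big_ord_recl big_ord1 /=; congr (_ + _ * g _); apply: val_inj.
have [a [b fE]] := (mE f).1 curve_in_max.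
have [ma|] := pselect (m a); last first.
  by move=> ma; exists (g ord_max); exact: exchange_generator mE fE ma.
have [mb|mb] := pselect (m b); last first.
  exists (g ord0); apply: (exchange_generator _ _ mb); last by rewrite fE addrC.
  by move=> x; rewrite mE; split=> [] [c [d ->]]; exists d, c; rewrite addrC.
case: f_notin_m2; rewrite fE; have [_ D _] := ideal_exp_ideal max_ideal 2.
have m1 x : m x -> ideal_exp m 1 x.
  by move=> mx; rewrite -[x]mulr1; apply: ideal_exp_mul.
apply: D; apply: ideal_exp_mul => //; apply/m1/mE.
  by exists 1, 0; rewrite mul1r mul0r addr0.
by exists 0, 1; rewrite mul1r mul0r add0r.
Qed.

Variable t : S.
Hypothesis mE : forall x, m x <-> exists a b, x = a * f + b * t.

Lemma prime_chain2 : exists P0 P1 : set S,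
  [/\ prime_ideal P0, prime_ideal P1, forall x, P0 x -> P1 x,
      exists x, P1 x /\ ~ P0 x & exists x, m x /\ ~ P1 x].
Proof.
have [_ _ [[P [P_prime P_lt]] _] _] := S_regular.
exists (P 0%N), (P 1%N).
have [P01 nP10] := P_lt 0%N isT; have [P12 nP21] := P_lt 1%N isT.
split; [exact: P_prime | exact: P_prime | exact: P01 | |].
  apply: contrapT => H; apply: nP10 => x P1x; apply: contrapT => nP0x.
  by apply: H; exists x.
apply: contrapT => H; apply: nP21 => x P2x; apply: contrapT => nP1x.
apply: H; exists x; split=> //; have [P2_id P2_1 _] := P_prime 2%N isT.
exact: proper_le_max P2_id P2_1 x P2x.
Qed.

Lemma max_in_prime (P : set S) : is_ideal P -> P f -> P t -> forall x, m x -> P x.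
Proof. by move=> [_ PD PM] Pf Pt x /mE[a [b ->]]; apply: PD; exact: PM. Qed.

Lemma divides0 x : divides (0 : S) x -> x = 0.
Proof. by case=> c ->; rewrite mulr0. Qed.

(** Here P = y P. Iterating with 0 as the base element leaves only the remainders, which lie in ever
    higher powers of [m]. *)
Lemma prime_div_zero (P : set S) y : prime_ideal P -> m y -> ~ P y ->
  (forall x, P x -> divides y x) -> forall x, P x -> x = 0.
Proof.
move=> [_ _ P_prime] my nPy Py x Px; apply: divides0.
apply: (iter_div (J := P) my) Px => w Pw; have [c wE] := Py w Pw.
exists 0, c; split; first by rewrite mulr0 add0r mulrC.
by move: Pw; rewrite wE => /P_prime[].
Qed.

(** Otherwise [f] generates [m], which leaves no room for a nonzero prime strictly below [m]. *)
Lemma curve_unif : ~ divides f t.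
Proof.
move=> [c tE].
have [P0 [P1 [P0_prime P1_prime P01 [y [P1y nP0y]] [x [mx nP1x]]]]] :=
  prime_chain2.
have m_f w : m w -> divides f w.
  by move=> /mE[a [b ->]]; rewrite tE mulrA -mulrDl; eexists.
have [P1_id P1_1 _] := P1_prime.
have nP1f : ~ P1 f.
  move=> P1f; apply: nP1x; have [d ->] := m_f x mx.
  by case: P1_id => _ _; apply.
apply: nP0y; rewrite (prime_div_zero P1_prime curve_in_max nP1f _ P1y).
  by case: P0_prime => -[].
by move=> w /(proper_le_max P1_id P1_1); exact: m_f.
Qed.

(** An element not of this form is no unit, so it is a f + b t, and [b] is again not of this form;
    iterating shows it divisible by [f]. *)
Lemma curve_dvr x : ~ divides f x ->
  exists v u N c, u * v = 1 /\ x = v * t ^+ N + c * f.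
Proof.
apply: contra_notP => nx.
have mt : m t by apply/mE; exists 0, 1; rewrite mul1r mul0r add0r.
pose J x := ~ exists v u N c, u * v = 1 /\ x = v * t ^+ N + c * f.
apply: (iter_div (J := J) mt) nx => w Jw.
have [/mE[a [b wE]]|[u uw]] := local_unit w.
  exists a, b; split; first by rewrite wE (mulrC t).
  move=> [v [u [N [c [uv bE]]]]]; apply: Jw.
  exists v, u, N.+1, (a + c * t); split=> //.
  by rewrite wE bE !mulrDl exprSr mulrA addrC -addrA (mulrAC c) [a * f + _]addrC.
case: Jw; exists w, u, 0%N, 0; split=> //.
by rewrite expr0 mulr1 mul0r addr0.
Qed.

(** Modulo [f] the ideal is generated by a power of [t], of least exponent. Its lift generates P:
    the remainder of each division is f times an element of P, since [f] is outside P, and the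
    division is iterated. *)
Lemma prime_principal (P : set S) : prime_ideal P -> ~ P f ->
  exists y, P y /\ forall x, P x -> divides y x.
Proof.
move=> P_prime nPf; have [[P0 PD PM] P1 Pp] := P_prime.
have [fP|] := pselect (forall x, P x -> divides f x).
  exists 0; split=> // x Px.
  by rewrite (prime_div_zero P_prime curve_in_max nPf fP Px); exists 0; rewrite mul0r.
move=> /existsNP[x0] /not_implyP[Px0 nfx0].
have PB x y : P x -> P y -> P (x - y).
  by move=> Px Py; apply: PD => //; rewrite -mulN1r; exact: PM.
have P_pow x : P x -> ~ divides f x -> exists N v c,
    x = v * t ^+ N + c * f /\ exists c', P (t ^+ N + c' * f).
  move=> Px /curve_dvr[v [u [N [c [uv xE]]]]]; exists N, v, c; split=> //.
  exists (u * c); have := PM u x Px; rewrite xE mulrDr !mulrA uv mul1r //.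
have [N0 [_ [_ [_ PN0]]]] := P_pow x0 Px0 nfx0.
have exN : exists N, `[< exists c, P (t ^+ N + c * f) >] by exists N0; apply/asboolP.
have := ex_minnP exN; case=> N /asboolP[c Py] N_min.
exists (t ^+ N + c * f); split=> // x Px.
apply: (iter_div (J := P) curve_in_max) Px => w Pw.
have [[d wE]|] := pselect (divides f w).
  exists 0, d; split; first by rewrite mul0r add0r mulrC.
  by move: Pw; rewrite wE => /Pp[].
move=> /(P_pow w Pw)[N' [v [d [wE PN']]]].
have NN' : (N <= N')%N by apply: N_min; apply/asboolP.
set y := t ^+ N + c * f; pose z := v * t ^+ (N' - N).
have wzE : w - z * y = (d - z * c) * f.
  rewrite wE /y /z mulrDr -(mulrA v) -exprD subnK // opprD addrACA subrr add0r.
  by rewrite mulrBl mulrA.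
exists z, (d - z * c); split; first by rewrite (mulrC f) -wzE addrC subrK.
have : P ((d - z * c) * f) by rewrite -wzE; apply: PB => //; exact: PM.
by case/Pp.
Qed.

(** The middle prime of a chain of length 2 is principal: it is (f) if it contains [f], for
    otherwise it would contain [t] and all of [m]. The prime below it is then zero by
    [prime_div_zero]. *)
Lemma regular_domain (x y : S) : x * y = 0 -> x = 0 \/ y = 0.
Proof.
have [P0 [P1 [P0_prime P1_prime P01 [w [P1w nP0w]] [z [mz nP1z]]]]] := prime_chain2.
have [P1_id P1_1 P1p] := P1_prime.
have [g [P1g gP]] : exists g, P1 g /\ forall x, P1 x -> divides g x.
  have [P1f|] := pselect (P1 f); last exact: prime_principal.
  exists f; split=> // q P1q; apply: contrapT => /curve_dvr[v [u [N [c [uv qE]]]]].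
  have [P10 P1D P1M] := P1_id.
  have P1tN : P1 (t ^+ N).
    have -> : t ^+ N = u * q + - (u * c) * f.
      by rewrite qE mulrDr !mulrA uv mul1r mulNr addrK.
    by apply: P1D; exact: P1M.
  have P1t : P1 t.
    elim: N P1tN {qE} => [|N IHN]; first by rewrite expr0 => /P1_1.
    by rewrite exprS => /P1p[].
  by apply: nP1z; exact: max_in_prime P1_id P1f P1t z mz.
have P00 : forall x, P0 x -> x = 0.
  apply: (prime_div_zero (y := g) P0_prime); first exact: proper_le_max P1_id P1_1 g P1g.
    move=> P0g; apply: nP0w; have [c ->] := gP w P1w.
    by case: P0_prime => -[_ _ P0M] _ _; exact: P0M.
  by move=> q /P01; exact: gP.
have [[P0_0 _ _] _ P0p] := P0_prime.
by move=> xy; case: (P0p x y); rewrite ?xy // => /P00; [left | right].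
Qed.

End Curve.

(** * The components of the curve *)

Section Components.
Variables (n : nat) (f : 'I_n.+1 -> S).
Hypothesis f_prime : forall i, prime_element (f i).
Hypothesis f_notin_m2 : forall i, ~ ideal_exp m 2 (f i).
Hypothesis R_reduced : reduced_ring (hypersurface f).

Lemma surface_domain (x y : S) : x * y = 0 -> x = 0 \/ y = 0.
Proof.
have [t tE] := curve_parameter (f_prime ord0) (@f_notin_m2 ord0).
exact: (regular_domain (f_prime ord0) tE).
Qed.

(* If f i divides f j, the product of the f k with k <> i has its square, hence
   itself, in the ideal of the product of all f k. *)
Lemma components_coprime i j : i != j -> ~ divides (f i) (f j).
Proof.
move=> ij [c fjE]; set p := \prod_k f k; pose x := \prod_(k | k != i) f k.
have pE : p = f i * x by rewrite /p (bigD1 i).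
have xE : x = f j * \prod_(k | (k != i) && (k != j)) f k.
  by rewrite /x (bigD1 j) // eq_sym.
set h := \prod_(k | _) _ in xE.
have x2 : x * x = c * h * p.
  by rewrite {1}xE fjE pE -!mulrA; congr (c * _); rewrite mulrCA.
have : (pquot_pi p x : hypersurface f) = 0.
  apply: (R_reduced (k := 2)); rewrite expr2.
  rewrite -[LHS]/(pquot_mul _ _) pquot_piM.
  by apply/pquot_pi_eq0; exists (c * h).
move=> /pquot_pi_eq0[d]; rewrite -/p pE mulrA => xd.
have /surface_domain[x0|/eqP] : x * (1 - d * f i) = 0.
- by rewrite mulrBr mulr1 {1}xd mulrC subrr.
- have : x <> 0; last by [].
  rewrite /x; elim/big_ind: _ => [|y z y0 z0 /surface_domain[]//|k _].
    by apply/eqP; exact: oner_neq0.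
  by case: (f_prime k).
rewrite subr_eq0 => /eqP d1; have [_ nf1 _] := f_prime i.
by apply: nf1; exists d.
Qed.

Lemma components_curve_system :
  exists t, curve_system m n.+1 (fun k => f (inord k)) t.
Proof.
have tex i := curve_parameter (f_prime i) (@f_notin_m2 i).
pose t k := sval (cid (tex (inord k))).
have tE k x : m x <-> exists a b, x = a * f (inord k) + b * t k.
  by rewrite /t; case: cid.
exists t; split.
- exact: max_ideal.
- exact: local_unit.
- exact: max_proper.
- by move=> k _; exact: tE.
- exact: surface_domain.
- by move=> k _; exact: f_prime.
- by move=> k _; exact: (curve_unif (f_prime _) (tE k)).
- move=> k _ x /(curve_dvr (tE k))[v [u [N [c [uv ->]]]]].
  by exists u, N, (u * c); rewrite mulrDr !mulrA uv mul1r.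
move=> i j i_lt j_lt ij; apply: components_coprime.
by apply/eqP => /(congr1 val); rewrite /= !inordK.
Qed.

End Components.
End RegularSurface.

(** * The endomorphism ring *)

Section EndomorphismsOfT.
Variables (S : comNzRingType) (n : nat) (f : 'I_n.+1 -> S).

Local Notation R := (hypersurface f).
Local Notation T := (sum_partial_normalizations f).
Local Notation A := (endo T).
Local Notation P := (partial_prod f).
Local Notation piR := (pquot_pi (\prod_(j < n.+1) f j) : S -> R).

Definition pn_pi i (x : S) : partial_normalization f i := pquot_pi (P i) x.
Definition component (u : T) i : partial_normalization f i := u i.

Lemma component_eq (u v : T) : (forall i, component u i = component v i) -> u = v.
Proof. by move=> uv; apply: functional_extensionality_dep => i; exact: uv. Qed.

Lemma componentD u v i : component (u + v) i = component u i + component v i.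
Proof. by []. Qed.

Lemma pn_pi_surj i (y : partial_normalization f i) : exists x, y = pn_pi i x.
Proof. by exists (pquot_repr y); rewrite /pn_pi pquot_reprK. Qed.

Lemma piR_surj (r : R) : exists x, r = piR x.
Proof. by exists (pquot_repr r); rewrite pquot_reprK. Qed.

Lemma pn_piD i x y : pn_pi i (x + y) = pn_pi i x + pn_pi i y.
Proof. exact: pquot_piD. Qed.

Lemma pn_pi_eq i x y : pn_pi i x = pn_pi i y <-> divides (P i) (x - y).
Proof. exact: pquot_eq. Qed.

Lemma pn_pi_eq0 i x : pn_pi i x = 0 <-> divides (P i) x.
Proof. exact: pquot_pi_eq0. Qed.

Lemma componentZ x u i y :
  component u i = pn_pi i y -> component (piR x *: u) i = pn_pi i (x * y).
Proof.
rewrite -[component (_ *: _) i]/(pn_map i (piR x) * component u i) => ->.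
by rewrite pn_map_pi; exact: pquot_piM.
Qed.

Definition mu_fun i j (c : S) (u : T) : T :=
  fun l => if l == j then pn_pi l (c * pquot_repr (component u i)) else 0.

(** The condition for multiplication by [c] to descend to a map from S/(P i) to S/(P j). *)
Definition admissible i j c := divides (P j) (c * P i).

Lemma mu_funE i j c u x : admissible i j c -> component u i = pn_pi i x ->
  forall l, component (mu_fun i j c u) l = if l == j then pn_pi l (c * x) else 0.
Proof.
move=> [d dE] ux l; rewrite /component /mu_fun; case: eqP => // ->.
apply/pn_pi_eq; rewrite -mulrBr.
have /pn_pi_eq[z ->] : pn_pi i (pquot_repr (component u i)) = pn_pi i x.
  by rewrite -ux /pn_pi pquot_reprK.
by exists (z * d); rewrite mulrCA dE mulrA.
Qed.

Fact mu_linear i j c : admissible i j c -> linear (mu_fun i j c).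
Proof.
move=> adm r u v; have [s ->] := piR_surj r; apply: component_eq => l.
have [x ux] := pn_pi_surj (component u i); have [y vy] := pn_pi_surj (component v i).
rewrite (@mu_funE _ _ _ _ (s * x + y) adm); last first.
  by rewrite componentD (componentZ _ ux) vy pn_piD.
have ul := mu_funE adm ux l; have vl := mu_funE adm vy l.
rewrite componentD vl; case: (l == j) ul {vl} => ul.
  by rewrite (componentZ _ ul) -pn_piD mulrDr mulrCA.
have ul0 : component (mu_fun i j c u) l = pn_pi l 0.
  by rewrite ul; apply/esym/pn_pi_eq0; exists 0; rewrite mul0r.
by rewrite (componentZ _ ul0) mulr0 addr0; apply/esym/pn_pi_eq0; exists 0; rewrite mul0r.
Qed.

(* The map S/(P i) -> S/(P j) of multiplication by c, junk 0 if ill-defined. *)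
Definition mu i j c : A :=
  if pselect (admissible i j c) is left adm then mk_linear (mu_linear adm) else 0.

Lemma muE i j c u x : admissible i j c -> component u i = pn_pi i x ->
  forall l, component (endo_fun (mu i j c) u) l = if l == j then pn_pi l (c * x) else 0.
Proof.
by move=> adm ux l; rewrite /mu; case: pselect => // adm'; exact: mu_funE.
Qed.

Lemma endo_eq (phi psi : A) :
  (forall u l, component (endo_fun phi u) l = component (endo_fun psi u) l) ->
  phi = psi.
Proof. by move=> H; apply: endoP => u; apply: component_eq => l; exact: H. Qed.

Lemma mu_comp i j l c d : admissible i j c -> admissible j l d ->
  mu j l d * mu i j c = mu i l (d * c).
Proof.
move=> adm_c adm_d; have adm : admissible i l (d * c).
  have [x xE] := adm_c; have [y yE] := adm_d; exists (x * y).
  by rewrite -mulrA xE mulrCA yE mulrA.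
apply: endo_eq => u k; have [x ux] := pn_pi_surj (component u i).
rewrite -[endo_fun (_ * _) u]/(endo_fun (mu j l d) (endo_fun (mu i j c) u)).
have uj := muE adm_c ux j; rewrite eqxx in uj.
by rewrite (muE adm_d uj) (muE adm ux) mulrA.
Qed.

Fact scale_linear (r : R) : linear (fun u : T => r *: u).
Proof. by move=> s u v; rewrite scalerDr !scalerA mulrC. Qed.

Definition scalar (s : S) : A := mk_linear (scale_linear (piR s)).

Lemma scalarE s u : endo_fun (scalar s) u = piR s *: u.
Proof. by []. Qed.

Lemma endo_funZ (phi : A) (r : R) u : endo_fun phi (r *: u) = r *: endo_fun phi u.
Proof. by rewrite /endo_fun linearZ. Qed.

Lemma scalarD s s' : scalar (s + s') = scalar s + scalar s'.
Proof. by apply: endoP => u; rewrite scalarE pquot_piD scalerDl. Qed.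

Lemma scalarM s s' : scalar (s * s') = scalar s * scalar s'.
Proof.
apply: endoP => u; rewrite scalarE -[RHS]/(piR s *: (piR s' *: u)) scalerA.
by congr (_ *: u); exact/esym/pquot_piM.
Qed.

Lemma scalar1 : scalar 1 = 1.
Proof. by apply: endoP => u; rewrite scalarE -[RHS]scale1r. Qed.

Lemma scalarC s (phi : A) : scalar s * phi = phi * scalar s.
Proof. by apply: endoP => u; exact/esym/(endo_funZ phi). Qed.

Lemma scalar_mu s i j c : admissible i j c -> scalar s * mu i j c = mu i j (s * c).
Proof.
move=> adm; have adm' : admissible i j (s * c).
  by have [x xE] := adm; exists (s * x); rewrite -mulrA xE mulrA.
apply: endo_eq => u k; have [x ux] := pn_pi_surj (component u i).
rewrite -[endo_fun (_ * _) u]/(piR s *: endo_fun (mu i j c) u).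
have uk := muE adm ux k; rewrite (muE adm' ux); case: (k == j) uk => uk.
  by rewrite (componentZ _ uk) mulrA.
have uk0 : component (endo_fun (mu i j c) u) k = pn_pi k 0.
  by rewrite uk; apply/esym/pn_pi_eq0; exists 0; rewrite mul0r.
by rewrite (componentZ _ uk0) mulr0; apply/pn_pi_eq0; exists 0; rewrite mul0r.
Qed.

Lemma admissible1 i : admissible i i 1.
Proof. by exists 1. Qed.

Definition basis_vector i : T := fun l => if l == i then pn_pi l 1 else 0.

Lemma component_basis i : component (basis_vector i) i = pn_pi i 1.
Proof. by rewrite /component /basis_vector eqxx. Qed.

Lemma mu_id_basis i u x : component u i = pn_pi i x ->
  endo_fun (mu i i 1) u = piR x *: basis_vector i.
Proof.
move=> ux; apply: component_eq => l; rewrite (muE (admissible1 i) ux) mul1r.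
have [->|li] := eqVneq l i; first by rewrite (componentZ _ (component_basis i)) mulr1.
have bl : component (basis_vector i) l = pn_pi l 0.
  rewrite /component /basis_vector (negPf li); apply/esym/pn_pi_eq0.
  by exists 0; rewrite mul0r.
by rewrite (componentZ _ bl) mulr0; apply/esym/pn_pi_eq0; exists 0; rewrite mul0r.
Qed.

(** A map out of a cyclic summand is determined by the image [c] of 1, and [c] is admissible because
    P_i kills 1. *)
Lemma endo_entry (phi : A) i j : exists c,
  admissible i j c /\ mu j j 1 * phi * mu i i 1 = mu i j c.
Proof.
have [c cE] := pn_pi_surj (component (endo_fun phi (basis_vector i)) j).
have adm : admissible i j c.
  have zero : piR (P i) *: basis_vector i = 0.
    apply: component_eq => l; have [->|li] := eqVneq l i.
      by rewrite (componentZ _ (component_basis i)) mulr1;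
        apply/pn_pi_eq0; exists 1; rewrite mul1r.
    have bl : component (basis_vector i) l = pn_pi l 0.
      rewrite /component /basis_vector (negPf li); apply/esym/pn_pi_eq0.
      by exists 0; rewrite mul0r.
    by rewrite (componentZ _ bl) mulr0; apply/pn_pi_eq0; exists 0; rewrite mul0r.
  have := componentZ (P i) cE; rewrite -endo_funZ zero.
  rewrite -[X in endo_fun phi X](scale0r (0 : T)) endo_funZ scale0r => /esym/pn_pi_eq0.
  by rewrite mulrC.
exists c; split=> //; apply: endo_eq => u l; have [x ux] := pn_pi_surj (component u i).
rewrite -[endo_fun _ u]/(endo_fun (mu j j 1) (endo_fun phi (endo_fun (mu i i 1) u))).
rewrite (mu_id_basis ux) endo_funZ.
by rewrite (muE (admissible1 j) (componentZ x cE)) (muE adm ux) mul1r mulrC.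
Qed.

Lemma mu_eq0 i x : mu i i x = 0 <-> divides (P i) x.
Proof.
have adm : admissible i i x by exists x.
split=> [mu0|xP].
  have := muE adm (component_basis i) i; rewrite mu0 eqxx mulr1.
  by move=> /esym/pn_pi_eq0.
apply: endo_eq => u l; have [y uy] := pn_pi_surj (component u i).
rewrite (muE adm uy); case: eqP => // ->; apply/pn_pi_eq0.
by have [z ->] := xP; exists (z * y); rewrite mulrAC.
Qed.

Lemma mu_sum : \sum_i mu i i 1 = 1.
Proof.
apply: endo_eq => u l.
have endo_sum (phi : 'I_n.+1 -> A) : component (endo_fun (\sum_i phi i) u) l =
    \sum_i component (endo_fun (phi i) u) l.
  by apply: (big_morph (fun phi : A => component (endo_fun phi u) l)).
rewrite endo_sum (bigD1 l) //= big1 => [|i il].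
  have [x ux] := pn_pi_surj (component u l).
  by rewrite (muE (admissible1 l) ux) eqxx mul1r addr0 ux.
have [x ux] := pn_pi_surj (component u i).
by rewrite (muE (admissible1 i) ux) eq_sym (negPf il).
Qed.

Local Notation F := (fun k => f (inord k)).

Lemma partial_prod_G k : (k < n.+1)%N -> P (inord k) = G F k.
Proof.
move=> kn; rewrite /partial_prod /G inordK //.
rewrite (big_ord_widen_cond n.+1 xpredT F kn).
by apply: eq_big => [i|i _]; rewrite ?inord_val ?ltnS.
Qed.

Hypothesis S_domain : forall x y : S, x * y = 0 -> x = 0 \/ y = 0.
Hypothesis f_neq0 : forall i, f i <> 0.

Lemma G_neq0 k : G F k <> 0.
Proof.
rewrite /G; elim/big_ind: _ => [|x y x0 y0 /S_domain[]//|k' _]; last exact: f_neq0.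
by apply/eqP; exact: oner_neq0.
Qed.

Lemma G_weight_eq k d : G F (k + d) = weight F k d * G F k.
Proof.
elim: d => [|d IHd]; first by rewrite addn0 /weight big_ord0 mul1r.
rewrite addnS /G big_ord_recr -/(G F (k + d)) IHd /weight big_ord_recr /=.
by rewrite mulrAC.
Qed.

Let e k : A := mu (inord k) (inord k) 1.
Let a k : A := mu (inord k.+1) (inord k) 1.
Let b k : A := mu (inord k) (inord k.+1) (f (inord k.+1)).

Lemma admissible_up k d : (k + d < n.+1)%N ->
  admissible (inord k) (inord (k + d)) (weight F k d).
Proof.
move=> kd; exists 1; rewrite mul1r !partial_prod_G ?G_weight_eq //.
by apply: leq_ltn_trans kd; rewrite leq_addr.
Qed.

Lemma admissible_down k d : (k + d < n.+1)%N ->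
  admissible (inord (k + d)) (inord k) 1.
Proof.
move=> kd; exists (weight F k d); rewrite mul1r !partial_prod_G ?G_weight_eq //.
by apply: leq_ltn_trans kd; rewrite leq_addr.
Qed.

Lemma weight1 k : weight F k 1 = f (inord k.+1).
Proof. by rewrite /weight big_ord1 addn0. Qed.

Lemma admissible_a k : (k.+1 < n.+1)%N -> admissible (inord k.+1) (inord k) 1.
Proof. by move=> kn; have := @admissible_down k 1; rewrite addn1; apply. Qed.

Lemma admissible_b k : (k.+1 < n.+1)%N ->
  admissible (inord k) (inord k.+1) (f (inord k.+1)).
Proof. by move=> kn; have := @admissible_up k 1; rewrite addn1 weight1; apply. Qed.

Lemma up_path_mu k d : (k + d < n.+1)%N ->
  up_path e b k d = mu (inord k) (inord (k + d)) (weight F k d).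
Proof.
elim: d => [|d IHd] kd; first by rewrite /weight big_ord0 addn0.
have kd' : (k + d < n.+1)%N by apply: leq_trans kd; rewrite addnS.
have kd1 : ((k + d).+1 < n.+1)%N by rewrite -addnS.
rewrite /= IHd // mu_comp; last exact: admissible_b; last exact: admissible_up.
by rewrite addnS /weight big_ord_recr /= mulrC.
Qed.

Lemma down_path_mu k d : (k + d < n.+1)%N ->
  down_path e a k d = mu (inord (k + d)) (inord k) 1.
Proof.
elim: d => [|d IHd] kd; first by rewrite addn0.
have kd' : (k + d < n.+1)%N by apply: leq_trans kd; rewrite addnS.
have kd1 : ((k + d).+1 < n.+1)%N by rewrite -addnS.
rewrite /= IHd // mu_comp; first by rewrite addnS mulr1.
  exact: admissible_a.
exact: admissible_down.
Qed.

Lemma endo_double_quiver : double_quiver n.+1 F scalar e a b.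
Proof.
have adm1 := admissible1.
split.
- exact: scalarD.
- exact: scalarM.
- exact: scalar1.
- exact: scalarC.
- by move=> k _; rewrite mu_comp // mulr1.
- by rewrite -mu_sum; apply: eq_bigr => k _; rewrite /e inord_val.
- by move=> k kn; rewrite mu_comp ?mulr1 //; exact: admissible_a.
- by move=> k kn; rewrite mu_comp ?mulr1 //; exact: admissible_a.
- by move=> k kn; rewrite mu_comp ?mul1r //; exact: admissible_b.
- by move=> k kn; rewrite mu_comp ?mulr1 //; exact: admissible_b.
- move=> k kn; rewrite mu_comp; last exact: admissible_a; last exact: admissible_b.
  by rewrite scalar_mu // mul1r mulr1.
- move=> k kn; rewrite mu_comp; last exact: admissible_b; last exact: admissible_a.
  by rewrite scalar_mu // mulr1.
- by move=> k x kn; rewrite scalar_mu // mulr1 mu_eq0 partial_prod_G.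
- move=> k d r kd; have kn : (k < n.+1)%N by apply: leq_ltn_trans kd; rewrite leq_addr.
  have [c [adm ->]] := endo_entry r (inord k) (inord (k + d)).
  (* Admissibility reads c G_k = x G_(k+d); cancelling G_k in the domain makes [c] a multiple of the
     weight, hence of the upward path. *)
  rewrite up_path_mu //; have [x] := adm; rewrite !partial_prod_G // G_weight_eq mulrA.
  move=> /eqP; rewrite -subr_eq0 -mulrBl => /eqP /S_domain[|/G_neq0 //].
  move=> /eqP; rewrite subr_eq0 => /eqP ->; exists x.
  by rewrite scalar_mu //; exact: admissible_up.
move=> k d r kd; have [c [_ ->]] := endo_entry r (inord (k + d)) (inord k).
by exists c; rewrite down_path_mu // scalar_mu ?mulr1 //; exact: admissible_down.
Qed.

End EndomorphismsOfT.

Theorem corollary4p7 (S : comNzRingType) (m : set S) (n : nat) (f : 'I_n -> S)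
  (S_regular : regular_local_ring m 2)
  (S_complete : adic_complete m)
  (n_ge2 : (2 <= n)%N)
  (f_prime : forall i, prime_element (f i))
  (f_notin_m2 : forall i, ~ ideal_exp m 2 (f i))
  (R_reduced : reduced_ring (hypersurface f)) :
  gldim (endo (sum_partial_normalizations f)) 3.
Proof.
(* Two vertices are needed for the lower bound: for n = 1 the ring is the discrete valuation ring
   S/(f_1), of global dimension 1. *)
case: n => [|n] in f n_ge2 f_prime f_notin_m2 R_reduced *; first by [].
have [t CS] := components_curve_system S_regular S_complete f_prime f_notin_m2 R_reduced.
have f_neq0 i : f i <> 0 by case: (f_prime i).
have DQ := endo_double_quiver (cs_domain CS) f_neq0.
split; first exact: (double_quiver_lgldim CS DQ n_ge2).
exact: (double_quiver_lgldim CS (double_quiver_opp DQ) n_ge2).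
Qed.
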